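(* Let $\alpha=e^{-i\pi/4}$. For $0<\mathrm{Re}(s)<1$ and $z\in\mathbb{R}\cup i\mathbb{R}$ define $$\varphi^{\zeta}_s(z)=e^{i\frac{z^2}{2}}\int_0^\infty\Big(\sum_{n\neq0}e^{(\alpha z-i\sqrt{\pi}nx)^2}-\frac1x\Big)x^{-s}\,dx .$$ Then for every $s$ with $0<\mathrm{Re}(s)<1$ and every real $z$, $$\varphi^{\zeta}_s(z)=\varphi^{\zeta}_{1-s}(iz).$$
   Context: The sum over $n\neq 0$ runs over all nonzero integers. *)

(* Defs.v *)
From Stdlib Require Import Reals ZArith.
From Coquelicot Require Import Coquelicot.

Local Open Scope C_scope.

Definition cexp (w : C) : C :=
  (exp (Re w) * cos (Im w), exp (Re w) * sin (Im w))%R.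

(* Principal value [x^w = e^(w ln x)]; meaningful for [0 < x] only. *)
Definition cpower (x : R) (w : C) : C := cexp (w * RtoC (ln x)).

(* Coquelicot's [Series] is real-valued; this is the complex analogue, built
   from [is_series] with [iota] as [RInt_gen] is built from [is_RInt_gen]. *)
Definition csum (a : nat -> C) : C :=
  iota (T := C_R_CompleteNormedModule)
       (is_series (V := C_R_NormedModule) a).

(* Sum over the nonzero integers, as the sum over [n = 1, 2, 3, ...] plus the
   sum over [n = -1, -2, -3, ...] (two separate limits, not a symmetric one). *)
Definition sum_nonzero (a : Z -> C) : C :=
  csum (fun k : nat => a (Z.of_nat (S k)))
  + csum (fun k : nat => a (- Z.of_nat (S k))%Z).

Definition alpha : C := cexp (- Ci * RtoC (PI / 4)).

Definition phi_zeta_integrand (s z : C) (x : R) : C :=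
  (sum_nonzero (fun n : Z =>
      cexp ((alpha * z - Ci * RtoC (sqrt PI) * RtoC (IZR n) * RtoC x) ^ 2))
   - 1 / RtoC x) * cpower x (- s).

(* The integral over [(0, oo)] is improper at both ends.  The integrand makes
   sense for every complex [z]; the intended domain is [0 < Re s < 1] with [z]
   real or purely imaginary. *)
Definition phi_zeta (s z : C) : C :=
  cexp (Ci * (z ^ 2 / 2)) *
  RInt_gen (V := C_R_CompleteNormedModule)
    (phi_zeta_integrand s z) (at_right 0) (Rbar_locally p_infty).

(* Main.v *)
Require Import Defs.
From Stdlib Require Import Reals.
From Stdlib Require Import ZArith Lra Lia Psatz FunctionalExtensionality.
From Coquelicot Require Import Coquelicot.

(** The functional equation is the transformation [x -> 1/x] of the integral,
    under which the integrand is covariant by Jacobi's theta formula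
    [sum_mu exp ((w + 2 pi i mu)^2 / (4 tau))
       = sqrt (tau / pi) * sum_q exp (w q - tau q^2)]
    with [tau = pi / x^2] and [w = 2 sqrt pi alpha z / x]: the [n = 0] term of
    one theta series becomes the [1/x] subtracted from the other.

    The theta formula is proved by Polya's elementary method, which handles
    complex [w] without Fourier analysis.  Expand
    [cosh ((w + 2 pi i mu) / (2 l)) ^ (2 m)] by the binomial theorem and sum over
    the residues [mu] modulo [l]: only the binomial coefficients
    [C (2 m, m + l q)] survive.  With [l = 2 h + 1], [m = l M] and [M / l -> 1 / tau],
    the left side tends termwise to the Gaussians in [mu], and on the right the
    binomial coefficients tend to Gaussians in [q]; both passages to the limit
    are dominated. *)

(** * Limits and dominated convergence *)

Local Open Scope C_scope.

(** No analytic continuation is involved. Both integrals are cut at 1, and inversion carries the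
    piece of one over (0, 1) to the piece of the other over (1, oo). So only the behaviour at
    infinity is estimated: the integrand is O(x^(-1 - Re s)), integrable for [0 < Re s], and the
    same bound at [1 - s] settles the end at 0. The two improper integrals are then combinations of
    the same two numbers, which the Gaussian prefactors balance.

    [csum] and [RInt_gen] are description operators, so each value must come from an explicit limit.
    Every Gaussian is weakened, by completing the square, to a multiple of [exp (-|n|)]; a single
    Tannery lemma with this shape of domination then serves all limits of series.

    In Polya's method an odd number [l] of residues has representatives symmetric about 0, so
    [PI mu / l] stays within (-PI/2, PI/2), far from the points where [|cosh|] is again 1 and
    domination would fail. Taking [m] a multiple of [l] makes the surviving frequencies integers. *)

Definition Clim {T : Type} (F : (T -> Prop) -> Prop) (f : T -> C) (l : C) : Prop :=
  forall eps : R, (0 < eps)%R -> F (fun t => (Cmod (f t - l) < eps)%R).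

Section Clim_theory.

Context {T : Type} {F : (T -> Prop) -> Prop} {FF : Filter F}.

Lemma Clim_ext (f g : T -> C) (l : C) :
  F (fun t => f t = g t) -> Clim F f l -> Clim F g l.
Proof.
  intros Hfg Hf eps He.
  generalize (filter_and _ _ Hfg (Hf eps He)).
  apply filter_imp; intros t [<- H]; exact H.
Qed.

Lemma Clim_const (c : C) : Clim F (fun _ => c) c.
Proof.
  intros eps He; apply filter_forall; intros t.
  replace (c - c) with (RtoC 0) by ring. now rewrite Cmod_0.
Qed.

Lemma Clim_plus (f g : T -> C) (a b : C) :
  Clim F f a -> Clim F g b -> Clim F (fun t => f t + g t) (a + b).
Proof.
  intros Hf Hg eps He.
  assert (He2 : (0 < eps / 2)%R) by lra.
  generalize (filter_and _ _ (Hf _ He2) (Hg _ He2)).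
  apply filter_imp; intros t [H1 H2].
  replace (f t + g t - (a + b)) with ((f t - a) + (g t - b)) by ring.
  eapply Rle_lt_trans; [apply Cmod_triangle | lra].
Qed.

Lemma Clim_mult (f g : T -> C) (a b : C) :
  Clim F f a -> Clim F g b -> Clim F (fun t => f t * g t) (a * b).
Proof.
  intros Hf Hg eps He.
  assert (Ha := Cmod_ge_0 a). assert (Hb := Cmod_ge_0 b).
  (* The summand [eps] in the denominator forces [d < 1], so the quadratic error term is at most
     [d]. *)
  pose (d := (eps / (1 + Cmod a + Cmod b + eps))%R).
  assert (Hd : (0 < d)%R) by (apply Rdiv_lt_0_compat; lra).
  assert (Hde : (d * (1 + Cmod a + Cmod b + eps) = eps)%R) by (unfold d; field; lra).
  assert (Hd1 : (d < 1)%R) by nra.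
  generalize (filter_and _ _ (Hf _ Hd) (Hg _ Hd)).
  apply filter_imp; intros t [H1 H2].
  replace (f t * g t - a * b)
    with ((f t - a) * (g t - b) + ((f t - a) * b + a * (g t - b))) by ring.
  eapply Rle_lt_trans; [apply Cmod_triangle |].
  eapply Rle_lt_trans; [apply Rplus_le_compat_l, Cmod_triangle |].
  rewrite !Cmod_mult.
  assert (H3 := Cmod_ge_0 (f t - a)). assert (H4 := Cmod_ge_0 (g t - b)).
  nra.
Qed.

Lemma Clim_scal (c : C) (f : T -> C) (a : C) :
  Clim F f a -> Clim F (fun t => c * f t) (c * a).
Proof. intros Hf. apply Clim_mult; [apply Clim_const | exact Hf]. Qed.

Lemma Clim_filterlim (f : T -> C) (l : C) :
  Clim F f l <-> filterlim (U := C_R_NormedModule) f F (locally (T := C_R_NormedModule) l).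
Proof.
  rewrite (filterlim_locally_ball_norm (U := C_R_NormedModule) (FF := FF)).
  unfold ball_norm. split.
  - intros H eps. generalize (H eps (cond_pos eps)).
    apply filter_imp; intros t Ht. rewrite Cmod_norm in Ht. exact Ht.
  - intros H eps He. generalize (H (mkposreal eps He)).
    apply filter_imp; intros t Ht. rewrite Cmod_norm. exact Ht.
Qed.

Lemma Clim_RtoC (f : T -> R) (l : R) :
  filterlim f F (locally l) -> Clim F (fun t => RtoC (f t)) (RtoC l).
Proof.
  intros H eps He.
  assert (H1 := proj1 (filterlim_locally f l) H (mkposreal eps He)).
  revert H1; apply filter_imp; intros t Ht.
  rewrite <- RtoC_minus, Cmod_R. exact Ht.
Qed.

Lemma Clim_unique {PF : ProperFilter' F} (f : T -> C) (a b : C) :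
  Clim F f a -> Clim F f b -> a = b.
Proof.
  intros Ha Hb.
  apply (filterlim_locally_unique (V := C_R_NormedModule) (F := F) f);
    now apply Clim_filterlim.
Qed.

Lemma Clim_bound {PF : ProperFilter' F} (f : T -> C) (a : C) (M : R) :
  F (fun t => (Cmod (f t) <= M)%R) -> Clim F f a -> (Cmod a <= M)%R.
Proof.
  intros HM Ha. apply Rnot_lt_le; intros Hlt.
  assert (He : (0 < Cmod a - M)%R) by lra.
  apply (filter_not_empty (F := F)).
  generalize (filter_and _ _ HM (Ha _ He)). apply filter_imp; intros t [H1 H2].
  assert (H3 := Cmod_triangle (f t) (- (f t - a))).
  rewrite Cmod_opp in H3. replace (f t + - (f t - a)) with a in H3 by ring. lra.
Qed.

End Clim_theory.

(** * Complex series dominated by a geometric sequence *)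

Fixpoint csumn (a : nat -> C) (n : nat) : C :=
  match n with
  | O => 0
  | S n => csumn a n + a n
  end.

Lemma csumn_ext (a b : nat -> C) (n : nat) :
  (forall k, (k < n)%nat -> a k = b k) -> csumn a n = csumn b n.
Proof.
  induction n as [|n IH]; intros H; simpl; [reflexivity|].
  rewrite H by lia. rewrite IH; [reflexivity | intros; apply H; lia].
Qed.

Lemma csumn_plus (a b : nat -> C) (n : nat) :
  csumn (fun k => a k + b k) n = csumn a n + csumn b n.
Proof. induction n as [|n IH]; simpl; [ring | rewrite IH; ring]. Qed.

Lemma csumn_scal (c : C) (a : nat -> C) (n : nat) :
  csumn (fun k => c * a k) n = c * csumn a n.
Proof. induction n as [|n IH]; simpl; [ring | rewrite IH; ring]. Qed.

Lemma csumn_zero (n : nat) : csumn (fun _ => 0) n = 0.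
Proof. induction n as [|n IH]; simpl; [reflexivity | rewrite IH; ring]. Qed.

Lemma csumn_swap (a : nat -> nat -> C) (n m : nat) :
  csumn (fun i => csumn (a i) m) n = csumn (fun j => csumn (fun i => a i j) n) m.
Proof.
  induction n as [|n IH]; simpl.
  - symmetry; apply csumn_zero.
  - now rewrite IH, csumn_plus.
Qed.

Lemma csumn_add (a : nat -> C) (n m : nat) :
  csumn a (n + m) = csumn a n + csumn (fun k => a (n + k)%nat) m.
Proof.
  induction m as [|m IH]; simpl.
  - rewrite Nat.add_0_r; ring.
  - rewrite Nat.add_succ_r; simpl. rewrite IH; ring.
Qed.

Lemma csumn_first (a : nat -> C) (n : nat) :
  csumn a (S n) = a O + csumn (fun k => a (S k)) n.
Proof. change (S n) with (1 + n)%nat. rewrite csumn_add. simpl. ring. Qed.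

Lemma csumn_bound (a : nat -> C) (K : R) (n m : nat) :
  (forall k, (Cmod (a k) <= K * exp (- INR k))%R) ->
  (Cmod (csumn a (n + m) - csumn a n) <= 2 * K * exp (- INR n))%R.
Proof.
  intros Ha.
  assert (HK : (0 <= K)%R).
  { generalize (Ha O) (Cmod_ge_0 (a O)). simpl. rewrite Ropp_0, exp_0. lra. }
  (* The subtracted term lets the induction close: since [2 <= exp 1], [exp (-k) <= 2 * (exp (-k) -
     exp (-(k+1)))]. *)
  assert (H : (Cmod (csumn a (n + m) - csumn a n)
               <= 2 * K * (exp (- INR n) - exp (- INR (n + m))))%R).
  { induction m as [|m IH].
    - rewrite Nat.add_0_r.
      replace (csumn a n - csumn a n) with (RtoC 0) by ring. rewrite Cmod_0. lra.
    - rewrite Nat.add_succ_r. simpl csumn.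
      replace (csumn a (n + m) + a (n + m)%nat - csumn a n)
        with ((csumn a (n + m) - csumn a n) + a (n + m)%nat) by ring.
      eapply Rle_trans; [apply Cmod_triangle|].
      specialize (Ha (n + m)%nat).
      assert (He : (2 * exp (- INR (S (n + m))) <= exp (- INR (n + m)))%R).
      { replace (- INR (n + m))%R with (1 + - INR (S (n + m)))%R
          by (rewrite S_INR; ring).
        rewrite exp_plus. apply Rmult_le_compat_r; [left; apply exp_pos|].
        generalize (exp_ineq1 1). lra. }
      generalize (exp_pos (- INR (S (n + m)))). nra. }
  generalize (exp_pos (- INR (n + m))). nra.
Qed.

Lemma is_series_Clim (a : nat -> C) (l : C) :
  is_series (V := C_R_NormedModule) a l <-> Clim eventually (csumn a) l.
Proof.
  (* [sum_n] includes the term at its upper index, [csumn] does not; hence the shift by one. *)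
  assert (Hs : forall n, sum_n (G := C_R_NormedModule) a n = csumn a (S n)).
  { induction n as [|n IH].
    - rewrite sum_O. simpl. rewrite Cplus_0_l. reflexivity.
    - rewrite sum_Sn, IH. reflexivity. }
  rewrite Clim_filterlim. unfold is_series. split; intros H.
  - intros P HP. destruct (H P HP) as [N HN]. exists (S N). intros [|n] Hn; [lia|].
    rewrite <- Hs. apply HN; lia.
  - intros P HP. destruct (H P HP) as [N HN]. exists N. intros n Hn.
    rewrite Hs. apply HN; lia.
Qed.

Lemma csum_unique (a : nat -> C) (l : C) :
  Clim eventually (csumn a) l -> csum a = l.
Proof.
  intros H. apply is_series_Clim in H. unfold csum.
  apply (iota_filterlim_locally (V := C_R_CompleteNormedModule) (F := eventually)).
  exact H.
Qed.

Lemma exp_INR_opp (k : nat) : exp (- INR k) = (exp (- 1) ^ k)%R.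
Proof.
  induction k as [|k IH]; [simpl; now rewrite Ropp_0, exp_0|].
  simpl pow. rewrite <- IH, <- exp_plus. f_equal. rewrite S_INR; ring.
Qed.

Lemma csum_correct (a : nat -> C) (K : R) :
  (forall k, (Cmod (a k) <= K * exp (- INR k))%R) ->
  Clim eventually (csumn a) (csum a).
Proof.
  intros Ha.
  assert (Hex : ex_series (V := C_R_CompleteNormedModule) a).
  { apply (ex_series_le (V := C_R_CompleteNormedModule) a (fun k => K * exp (- 1) ^ k)%R).
    - intros k. rewrite <- exp_INR_opp.
      change (norm (a k)) with (norm (a k : C_R_NormedModule)).
      specialize (Ha k). rewrite Cmod_norm in Ha. exact Ha.
    - apply (ex_series_scal_l K (fun k => exp (- 1) ^ k)%R).
      apply ex_series_geom.
      rewrite Rabs_pos_eq by (left; apply exp_pos).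
      rewrite <- exp_0. apply exp_increasing. lra. }
  destruct Hex as [l Hl]. apply is_series_Clim in Hl.
  now rewrite (csum_unique a l Hl).
Qed.

Lemma csum_tail (a : nat -> C) (K : R) (n : nat) :
  (forall k, (Cmod (a k) <= K * exp (- INR k))%R) ->
  (Cmod (csum a - csumn a n) <= 2 * K * exp (- INR n))%R.
Proof.
  intros Ha.
  apply (Clim_bound (F := eventually) (fun m => csumn a m - csumn a n)).
  - exists n. intros m Hm. replace m with (n + (m - n))%nat by lia.
    now apply csumn_bound.
  - apply (Clim_plus (F := eventually)); [now apply csum_correct with K | apply Clim_const].
Qed.

Lemma csum_bound (a : nat -> C) (K : R) :
  (forall k, (Cmod (a k) <= K * exp (- INR k))%R) -> (Cmod (csum a) <= 2 * K)%R.
Proof.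
  intros Ha. generalize (csum_tail a K 0 Ha). simpl.
  replace (csum a - 0) with (csum a) by ring. rewrite Ropp_0, exp_0. lra.
Qed.

Lemma csum_plus (a b : nat -> C) (K : R) :
  (forall k, (Cmod (a k) <= K * exp (- INR k))%R) ->
  (forall k, (Cmod (b k) <= K * exp (- INR k))%R) ->
  csum (fun k => a k + b k) = csum a + csum b.
Proof.
  intros Ha Hb. apply csum_unique.
  apply Clim_ext with (fun n => csumn a n + csumn b n).
  - apply filter_forall; intros n; symmetry; apply csumn_plus.
  - apply Clim_plus; eapply csum_correct; eassumption.
Qed.

Lemma csum_scal (c : C) (a : nat -> C) (K : R) :
  (forall k, (Cmod (a k) <= K * exp (- INR k))%R) ->
  csum (fun k => c * a k) = c * csum a.
Proof.
  intros Ha. apply csum_unique.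
  apply Clim_ext with (fun n => c * csumn a n).
  - apply filter_forall; intros n; symmetry; apply csumn_scal.
  - apply Clim_scal; eapply csum_correct; eassumption.
Qed.

Lemma csum_ext (a b : nat -> C) : (forall k, a k = b k) -> csum a = csum b.
Proof.
  intros H. unfold csum.
  apply (f_equal (iota (T := C_R_CompleteNormedModule))).
  apply functional_extensionality; intros l.
  apply (f_equal (fun u => is_series (V := C_R_NormedModule) u l)).
  apply functional_extensionality; exact H.
Qed.

(** Dominated convergence for series. The filter is arbitrary because the same statement is needed
    along [eventually], for the theta formula, and along [locally x], for continuity of the
    integrand. *)
Lemma tannery {T : Type} {F : (T -> Prop) -> Prop} {PF : ProperFilter F}
    (g : T -> nat -> C) (g0 : nat -> C) (K : R) :
  F (fun t => forall k, (Cmod (g t k) <= K * exp (- INR k))%R) ->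
  (forall k, Clim F (fun t => g t k) (g0 k)) ->
  Clim F (fun t => csum (g t)) (csum g0).
Proof.
  intros HK Hg.
  assert (HF : ProperFilter' F) by now apply Proper_StrongProper.
  assert (Hg0 : forall k, (Cmod (g0 k) <= K * exp (- INR k))%R).
  { intros k. apply (Clim_bound (F := F) (fun t => g t k)); [|apply Hg].
    revert HK; apply filter_imp; auto. }
  assert (HK0 : (0 <= K)%R).
  { generalize (Hg0 O) (Cmod_ge_0 (g0 O)). simpl. rewrite Ropp_0, exp_0. lra. }
  assert (Hn : forall n, Clim F (fun t => csumn (g t) n) (csumn g0 n)).
  { induction n as [|n IH]; simpl; [apply Clim_const | apply Clim_plus; auto]. }
  intros eps He.
  (* Makes each tail smaller than [eps / 4]: it is at most [2 * K * exp (- (n + 1))], and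
     [8 * K / eps < n + 1 < exp (n + 1)]. *)
  destruct (nfloor_ex (8 * K / eps)) as [n Hnf].
  { apply Rmult_le_pos; [lra | left; now apply Rinv_0_lt_compat]. }
  assert (Hsmall : (8 * K * exp (- INR (S n)) < eps)%R).
  { rewrite S_INR, exp_Ropp.
    assert (H1 : (8 * K < eps * (INR n + 1))%R).
    { apply Rmult_lt_reg_r with (/ eps)%R; [now apply Rinv_0_lt_compat|].
      replace (eps * (INR n + 1) * / eps)%R with (INR n + 1)%R by (field; lra).
      apply Hnf. }
    generalize (exp_ineq1_le (INR n + 1)) (pos_INR n); intros H2 H3.
    apply Rmult_lt_reg_r with (exp (INR n + 1)); [apply exp_pos|].
    rewrite Rmult_assoc, Rinv_l by (apply Rgt_not_eq, exp_pos). nra. }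
  assert (He2 : (0 < eps / 2)%R) by lra.
  generalize (filter_and _ _ HK (Hn (S n) _ He2)).
  apply filter_imp; intros t [H1 H2].
  generalize (csum_tail (g t) K (S n) H1) (csum_tail g0 K (S n) Hg0); intros H3 H4.
  replace (csum (g t) - csum g0)
    with ((csumn (g t) (S n) - csumn g0 (S n))
          + ((csum (g t) - csumn (g t) (S n)) + - (csum g0 - csumn g0 (S n)))) by ring.
  eapply Rle_lt_trans; [apply Cmod_triangle|].
  eapply Rle_lt_trans; [apply Rplus_le_compat_l, Cmod_triangle|].
  rewrite Cmod_opp. lra.
Qed.

(** Padding by zeros turns finite sums of growing length into series over a fixed index set, to
    which [tannery] applies. *)
Lemma csumn_csum (a : nat -> C) (n : nat) :
  csumn a n = csum (fun k => if (k <? n)%nat then a k else 0).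
Proof.
  symmetry. apply csum_unique. intros eps He. exists n. intros m Hm.
  replace m with (n + (m - n))%nat by lia. rewrite csumn_add.
  rewrite (csumn_ext _ a n).
  2: { intros k Hk. apply Nat.ltb_lt in Hk. now rewrite Hk. }
  rewrite (csumn_ext _ (fun _ => 0) (m - n)).
  2: { intros k Hk. destruct (Nat.ltb_spec (n + k) n); [lia | reflexivity]. }
  rewrite csumn_zero. replace (csumn a n + 0 - csumn a n) with (RtoC 0) by ring.
  now rewrite Cmod_0.
Qed.

(** * Series over the integers, folded to one-sided series by pairing n with -n *)

Definition zpair (f : Z -> C) (k : nat) : C :=
  f (Z.of_nat (S k)) + f (- Z.of_nat (S k))%Z.

Definition zsumn (f : Z -> C) (h : nat) : C :=
  csumn (fun j => f (Z.of_nat j - Z.of_nat h)%Z) (2 * h + 1).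

Lemma zsumn_zpair (f : Z -> C) (h : nat) :
  zsumn f h = f 0%Z + csumn (zpair f) h.
Proof.
  induction h as [|h IH].
  - unfold zsumn; simpl. ring.
  - simpl csumn. rewrite Cplus_assoc, <- IH. unfold zsumn.
    replace (2 * S h + 1)%nat with (1 + (2 * h + 1) + 1)%nat by lia.
    remember (2 * h + 1)%nat as N eqn:HN.
    rewrite !csumn_add.
    rewrite (csumn_ext (fun k => f (Z.of_nat (1 + k) - Z.of_nat (S h))%Z)
               (fun j => f (Z.of_nat j - Z.of_nat h)%Z)).
    2: { intros k _. f_equal. lia. }
    unfold zpair, csumn at 1 3.
    replace (Z.of_nat (1 + N + 0) - Z.of_nat (S h))%Z with (Z.of_nat (S h)) by lia.
    replace (Z.of_nat 0 - Z.of_nat (S h))%Z with (- Z.of_nat (S h))%Z by lia.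
    ring.
Qed.

Lemma zpair_bound (f : Z -> C) (K : R) :
  (forall n, (Cmod (f n) <= K * exp (- Rabs (IZR n)))%R) ->
  forall k, (Cmod (zpair f k) <= 2 * K * exp (- INR k))%R.
Proof.
  intros Hf k. unfold zpair.
  eapply Rle_trans; [apply Cmod_triangle|].
  generalize (Hf (Z.of_nat (S k))) (Hf (- Z.of_nat (S k))%Z).
  assert (HK : (0 <= K)%R).
  { generalize (Hf 0%Z) (Cmod_ge_0 (f 0%Z)). rewrite Rabs_R0, Ropp_0, exp_0. lra. }
  rewrite opp_IZR, Rabs_Ropp, <- INR_IZR_INZ, Rabs_pos_eq by apply pos_INR.
  assert (He : (exp (- INR (S k)) <= exp (- INR k))%R).
  { left. apply exp_increasing. rewrite S_INR. lra. }
  intros; nra.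
Qed.

(** Domination makes the two one-sided series converge separately, which is what allows merging them
    into the paired one. *)
Lemma sum_nonzero_zpair (f : Z -> C) (K : R) :
  (forall n, (Cmod (f n) <= K * exp (- Rabs (IZR n)))%R) ->
  sum_nonzero f = csum (zpair f).
Proof.
  intros Hf.
  assert (HK : (0 <= K)%R).
  { generalize (Hf 0%Z) (Cmod_ge_0 (f 0%Z)). rewrite Rabs_R0, Ropp_0, exp_0. lra. }
  assert (He : forall k, (exp (- INR (S k)) <= exp (- INR k))%R).
  { intros k. left. apply exp_increasing. rewrite S_INR. lra. }
  unfold sum_nonzero, zpair. symmetry. apply csum_plus with K; intros k.
  - generalize (Hf (Z.of_nat (S k))) (He k).
    rewrite <- INR_IZR_INZ, Rabs_pos_eq by apply pos_INR. intros; nra.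
  - generalize (Hf (- Z.of_nat (S k))%Z) (He k).
    rewrite opp_IZR, Rabs_Ropp, <- INR_IZR_INZ, Rabs_pos_eq by apply pos_INR. intros; nra.
Qed.

Lemma zpair_lim {T : Type} {F : (T -> Prop) -> Prop} {FF : Filter F}
    (f : T -> Z -> C) (f0 : Z -> C) :
  (forall n, Clim F (fun t => f t n) (f0 n)) ->
  forall k, Clim F (fun t => zpair (f t) k) (zpair f0 k).
Proof. intros H k. apply Clim_plus; apply H. Qed.

Lemma tannery_zsum {T : Type} {F : (T -> Prop) -> Prop} {PF : ProperFilter F}
    (f : T -> Z -> C) (f0 : Z -> C) (K : R) :
  F (fun t => forall n, (Cmod (f t n) <= K * exp (- Rabs (IZR n)))%R) ->
  (forall n, Clim F (fun t => f t n) (f0 n)) ->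
  Clim F (fun t => f t 0%Z + csum (zpair (f t))) (f0 0%Z + csum (zpair f0)).
Proof.
  intros HK Hf. apply Clim_plus; [apply Hf|].
  apply tannery with (2 * K)%R.
  - revert HK; apply filter_imp; intros t Ht. now apply zpair_bound.
  - now apply zpair_lim.
Qed.

(** Domination is demanded only inside the window [|n| <= N h]: beyond it the terms of Polya's
    identity are not small, the powers of [cosh] being periodic in the summation index. *)
Lemma tannery_zsumn (N : nat -> nat) (f : nat -> Z -> C) (f0 : Z -> C) (K : R) :
  filterlim N eventually eventually ->
  eventually (fun h => forall n, (Z.abs n <= Z.of_nat (N h))%Z ->
    (Cmod (f h n) <= K * exp (- Rabs (IZR n)))%R) ->
  (forall n, Clim eventually (fun h => f h n) (f0 n)) ->
  Clim eventually (fun h => zsumn (f h) (N h)) (f0 0%Z + csum (zpair f0)).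
Proof.
  intros HN HK Hf.
  pose (g := fun h n => if (Z.abs n <=? Z.of_nat (N h))%Z then f h n else 0).
  apply Clim_ext with (fun h => g h 0%Z + csum (zpair (g h))).
  - apply filter_forall; intros h.
    rewrite zsumn_zpair, csumn_csum. f_equal.
    + unfold g. destruct (Z.leb_spec (Z.abs 0) (Z.of_nat (N h))); [reflexivity | lia].
    + apply csum_ext; intros k. unfold zpair, g.
      destruct (Nat.ltb_spec k (N h));
        destruct (Z.leb_spec (Z.abs (Z.of_nat (S k))) (Z.of_nat (N h)));
        destruct (Z.leb_spec (Z.abs (- Z.of_nat (S k))) (Z.of_nat (N h)));
        try lia; [reflexivity | ring].
  (* The sign of [K] is not given, and the bound must also dominate the zeros placed outside the
     window. *)
  - apply tannery_zsum with (Rmax K 0).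
    + revert HK; apply filter_imp; intros h Hh n. unfold g.
      generalize (exp_pos (- Rabs (IZR n))) (Rmax_l K 0) (Rmax_r K 0); intros H1 H2 H3.
      destruct (Z.leb_spec (Z.abs n) (Z.of_nat (N h))) as [H|H].
      * eapply Rle_trans; [now apply Hh|]. nra.
      * rewrite Cmod_0. nra.
    + intros n. apply Clim_ext with (fun h => f h n); [|apply Hf].
      destruct (HN (fun m => (Z.to_nat (Z.abs n) <= m)%nat)) as [h0 Hh0].
      { exists (Z.to_nat (Z.abs n)). auto. }
      exists h0. intros h Hh. specialize (Hh0 h Hh). unfold g.
      destruct (Z.leb_spec (Z.abs n) (Z.of_nat (N h))); [reflexivity | lia].
Qed.

(** * The complex exponential *)

Lemma cexp_0 : cexp 0 = 1.
Proof. unfold cexp; apply injective_projections; simpl; rewrite exp_0, ?cos_0, ?sin_0; ring. Qed.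

Lemma cexp_plus (a b : C) : cexp (a + b) = cexp a * cexp b.
Proof.
  destruct a as [a1 a2], b as [b1 b2].
  unfold cexp; apply injective_projections; simpl;
    rewrite exp_plus, ?cos_plus, ?sin_plus; ring.
Qed.

Lemma cexp_pow (a : C) (n : nat) : cexp a ^ n = cexp (RtoC (INR n) * a).
Proof.
  induction n as [|n IH].
  - simpl. rewrite Cmult_0_l. symmetry; apply cexp_0.
  - rewrite Cpow_S, IH, <- cexp_plus. f_equal. rewrite S_INR, RtoC_plus. ring.
Qed.

Lemma cexp_RtoC (x : R) : cexp (RtoC x) = RtoC (exp x).
Proof.
  unfold cexp; apply injective_projections; simpl; rewrite ?cos_0, ?sin_0; ring.
Qed.

Lemma Cmod_cexp (a : C) : Cmod (cexp a) = exp (Re a).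
Proof.
  unfold cexp, Cmod; simpl.
  replace (exp (Re a) * cos (Im a) * (exp (Re a) * cos (Im a) * 1) +
     exp (Re a) * sin (Im a) * (exp (Re a) * sin (Im a) * 1))%R
    with (exp (Re a) * exp (Re a) * (Rsqr (sin (Im a)) + Rsqr (cos (Im a))))%R
    by (unfold Rsqr; ring).
  rewrite sin2_cos2, Rmult_1_r. apply sqrt_square. left; apply exp_pos.
Qed.

Lemma Cmod_cexp_le (a : C) : (Cmod (cexp a) <= exp (Cmod a))%R.
Proof.
  rewrite Cmod_cexp.
  assert (H : (Re a <= Cmod a)%R).
  { eapply Rle_trans; [apply Rle_abs | apply re_le_Cmod]. }
  destruct H as [H|H]; [left; now apply exp_increasing | right; now rewrite H].
Qed.

Lemma cexp_2PI_Z (n : Z) : cexp (Ci * RtoC (2 * PI * IZR n)) = 1.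
Proof.
  unfold cexp.
  replace (Re (Ci * RtoC (2 * PI * IZR n))) with 0%R by (simpl; ring).
  replace (Im (Ci * RtoC (2 * PI * IZR n))) with (2 * PI * IZR n)%R by (simpl; ring).
  assert (Hs : sin (PI * IZR n) = 0%R) by (apply sin_eq_0_1; exists n; ring).
  replace (2 * PI * IZR n)%R with (2 * (PI * IZR n))%R by ring.
  rewrite exp_0, cos_2a_sin, sin_2a, Hs.
  apply injective_projections; simpl; ring.
Qed.

Lemma im_le_Cmod (c : C) : (Rabs (Im c) <= Cmod c)%R.
Proof. eapply Rle_trans; [apply Rmax_r | apply Rmax_Cmod]. Qed.

(** The mean value theorem is false for complex values; applying it to real and imaginary parts
    separately costs the factor 2. *)
Lemma mean_value_C (g dg : R -> C) (K : R) :
  (forall t, (0 <= t <= 1)%R ->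
     is_derive (fun t => Re (g t)) t (Re (dg t)) /\
     is_derive (fun t => Im (g t)) t (Im (dg t))) ->
  (forall t, (0 <= t <= 1)%R -> (Cmod (dg t) <= K)%R) ->
  (Cmod (g 1%R - g 0%R) <= 2 * K)%R.
Proof.
  intros Hd HK.
  assert (Hm : forall p dp : R -> R,
    (forall t, (0 <= t <= 1)%R -> is_derive p t (dp t)) ->
    (forall t, (0 <= t <= 1)%R -> (Rabs (dp t) <= K)%R) ->
    (Rabs (p 1%R - p 0%R) <= K)%R).
  { intros p dp H1 H2.
    destruct (MVT_gen p 0 1 dp) as [c [Hc ->]];
      rewrite ?Rmin_left, ?Rmax_right in * by lra.
    - intros x Hx; apply H1; lra.
    - intros x Hx. apply derivable_continuous_pt. exists (dp x).
      apply is_derive_Reals, H1, Hx.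
    - rewrite Rminus_0_r, Rmult_1_r. now apply H2. }
  replace (g 1%R - g 0%R) with
    (RtoC (Re (g 1%R) - Re (g 0%R)) + Ci * RtoC (Im (g 1%R) - Im (g 0%R)))
    by (destruct (g 1%R), (g 0%R); apply injective_projections; simpl; ring).
  eapply Rle_trans; [apply Cmod_triangle|].
  rewrite Cmod_mult, Cmod_Ci, !Cmod_R, Rmult_1_l.
  assert (H1 : (Rabs (Re (g 1%R) - Re (g 0%R)) <= K)%R).
  { apply (Hm (fun t => Re (g t)) (fun t => Re (dg t))); intros t Ht; [now apply Hd|].
    eapply Rle_trans; [apply re_le_Cmod | now apply HK]. }
  assert (H2 : (Rabs (Im (g 1%R) - Im (g 0%R)) <= K)%R).
  { apply (Hm (fun t => Im (g t)) (fun t => Im (dg t))); intros t Ht; [now apply Hd|].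
    eapply Rle_trans; [apply im_le_Cmod | now apply HK]. }
  lra.
Qed.

Lemma exp_le_mono (x y : R) : (x <= y)%R -> (exp x <= exp y)%R.
Proof. intros [H| ->]; [left; now apply exp_increasing | apply Rle_refl]. Qed.

Lemma Cmod_scal_le (t : R) (u : C) :
  (0 <= t <= 1)%R -> (Cmod (RtoC t * u) <= Cmod u)%R.
Proof.
  intros Ht. rewrite Cmod_mult, Cmod_R, Rabs_pos_eq by lra.
  generalize (Cmod_ge_0 u). nra.
Qed.

(** First of three Taylor remainders. Along [t * u] the derivative of each is [u] times the
    preceding one, and each use of [mean_value_C] costs a factor 2: whence the constants 2, 4, 8. *)
Lemma cexp_taylor0 (u : C) : (Cmod (cexp u - 1) <= 2 * Cmod u * exp (Cmod u))%R.
Proof.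
  generalize (mean_value_C (fun t => cexp (RtoC t * u)) (fun t => u * cexp (RtoC t * u))
    (Cmod u * exp (Cmod u))).
  rewrite Cmult_0_l, Cmult_1_l, cexp_0, Rmult_assoc. intros H; apply H; clear H.
  - destruct u as [a b]. intros t _. unfold cexp; simpl.
    split; auto_derive; trivial; simpl; unfold Rminus; ring.
  - intros t Ht. rewrite Cmod_mult. apply Rmult_le_compat_l; [apply Cmod_ge_0|].
    eapply Rle_trans; [apply Cmod_cexp_le|]. now apply exp_le_mono, Cmod_scal_le.
Qed.

Lemma cexp_taylor1 (u : C) :
  (Cmod (cexp u - 1 - u) <= 4 * Cmod u ^ 2 * exp (Cmod u))%R.
Proof.
  generalize (mean_value_C (fun t => cexp (RtoC t * u) - 1 - RtoC t * u)
    (fun t => u * (cexp (RtoC t * u) - 1)) (Cmod u * (2 * Cmod u * exp (Cmod u)))).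
  rewrite Cmult_0_l, Cmult_1_l, cexp_0.
  replace (cexp u - 1 - u - (1 - 1 - 0)) with (cexp u - 1 - u) by ring.
  replace (4 * Cmod u ^ 2 * exp (Cmod u))%R
    with (2 * (Cmod u * (2 * Cmod u * exp (Cmod u))))%R by ring.
  intros H; apply H; clear H.
  - destruct u as [a b]. intros t _. unfold cexp; simpl.
    split; auto_derive; trivial; simpl; unfold Rminus; ring.
  - intros t Ht. rewrite Cmod_mult. apply Rmult_le_compat_l; [apply Cmod_ge_0|].
    eapply Rle_trans; [apply cexp_taylor0|].
    generalize (Cmod_scal_le t u Ht) (Cmod_ge_0 (RtoC t * u)); intros H1 H2.
    apply Rmult_le_compat; [lra | left; apply exp_pos | lra | now apply exp_le_mono].
Qed.

Lemma cexp_taylor2 (u : C) :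
  (Cmod (cexp u - 1 - u - u * u / 2) <= 8 * Cmod u ^ 3 * exp (Cmod u))%R.
Proof.
  generalize (mean_value_C
    (fun t => cexp (RtoC t * u) - 1 - RtoC t * u - RtoC (t * t / 2) * (u * u))
    (fun t => u * (cexp (RtoC t * u) - 1 - RtoC t * u))
    (Cmod u * (4 * Cmod u ^ 2 * exp (Cmod u)))).
  rewrite Cmult_0_l, Cmult_1_l, cexp_0.
  replace (cexp u - 1 - u - RtoC (1 * 1 / 2) * (u * u) -
     (1 - 1 - 0 - RtoC (0 * 0 / 2) * (u * u))) with (cexp u - 1 - u - u * u / 2).
  2: { replace (0 * 0 / 2)%R with 0%R by field. rewrite RtoC_div, RtoC_mult by lra.
       field. }
  replace (8 * Cmod u ^ 3 * exp (Cmod u))%R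
    with (2 * (Cmod u * (4 * Cmod u ^ 2 * exp (Cmod u))))%R by ring.
  intros H; apply H; clear H.
  - destruct u as [a b]. intros t _. unfold cexp; simpl.
    split; auto_derive; trivial; simpl; unfold Rminus; field.
  - intros t Ht. rewrite Cmod_mult. apply Rmult_le_compat_l; [apply Cmod_ge_0|].
    eapply Rle_trans; [apply cexp_taylor1|].
    generalize (Cmod_scal_le t u Ht) (Cmod_ge_0 (RtoC t * u)); intros H1 H2.
    apply Rmult_le_compat; [nra | left; apply exp_pos | | now apply exp_le_mono].
    apply Rmult_le_compat_l; [lra|]. apply pow_incr; lra.
Qed.

Lemma Clim_cexp {T : Type} {F : (T -> Prop) -> Prop} {FF : Filter F} (f : T -> C) (l : C) :
  Clim F f l -> Clim F (fun t => cexp (f t)) (cexp l).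
Proof.
  intros Hf.
  assert (Hd : Clim F (fun t => cexp (f t - l)) 1).
  { intros eps He.
    (* With [|v| < 1] for [v = f t - l], the bound [2 * |v| * exp |v|] is at most [6 * |v|]. *)
    assert (Hm : (0 < Rmin 1 (eps / 6))%R) by (apply Rmin_glb_lt; lra).
    generalize (Hf _ Hm). apply filter_imp; intros t Ht.
    eapply Rle_lt_trans; [apply cexp_taylor0|].
    generalize (Rmin_l 1 (eps / 6)) (Rmin_r 1 (eps / 6)) (Cmod_ge_0 (f t - l)); intros.
    assert (exp (Cmod (f t - l)) <= 3)%R.
    { eapply Rle_trans; [|apply exp_le_3]. apply exp_le_mono; lra. }
    generalize (exp_pos (Cmod (f t - l))). nra. }
  apply Clim_ext with (fun t => cexp l * cexp (f t - l)).
  - apply filter_forall; intros t. rewrite <- cexp_plus. f_equal; ring.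
  - generalize (Clim_scal (cexp l) _ _ Hd). now rewrite Cmult_1_r.
Qed.

Lemma Cmod_pow_sub_le (a b : C) (r : R) (n : nat) :
  (1 <= r)%R -> (Cmod a <= r)%R -> (Cmod b <= r)%R ->
  (Cmod (a ^ n - b ^ n) <= INR n * Cmod (a - b) * r ^ n)%R.
Proof.
  intros Hr Ha Hb. induction n as [|n IH].
  - simpl. replace (1 - 1) with (RtoC 0) by ring. rewrite Cmod_0. lra.
  - rewrite !Cpow_S, S_INR.
    replace (a * a ^ n - b * b ^ n) with (a * (a ^ n - b ^ n) + (a - b) * b ^ n) by ring.
    eapply Rle_trans; [apply Cmod_triangle|].
    rewrite !Cmod_mult, Cmod_pow.
    assert (H1 : (Cmod b ^ n <= r ^ n)%R) by (apply pow_incr; split; [apply Cmod_ge_0 | auto]).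
    assert (H2 : (1 <= r ^ n)%R) by now apply pow_R1_Rle.
    generalize (Cmod_ge_0 (a - b)) (Cmod_ge_0 a) (Cmod_ge_0 (a ^ n - b ^ n)) (pos_INR n).
    intros H3 H4 H5 H6. simpl.
    assert (H7 : (Cmod a * Cmod (a ^ n - b ^ n) <= r * (INR n * Cmod (a - b) * r ^ n))%R)
      by (apply Rmult_le_compat; auto).
    assert (H8 : (Cmod (a - b) * Cmod b ^ n <= Cmod (a - b) * (r * r ^ n))%R)
      by (apply Rmult_le_compat_l; nra).
    nra.
Qed.

Definition ccosh (u : C) : C := (cexp u + cexp (- u)) / 2.

(** Both bases agree with [1 + u^2 / 2] to third order. Averaging two cubic remainders with
    [exp |u| <= 3] gives 24, the Gaussian base gives 3, hence 27; both bases have modulus at most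
    [1 + 25 |u|^2]. When [n] is of order [|u|^(-2)], as in Polya's identity, the total error is
    O(|u|). *)
Lemma ccosh_pow_approx (u : C) (n : nat) :
  (Cmod u <= 1)%R ->
  (Cmod (ccosh u ^ n - cexp (RtoC (INR n) * (u * u / 2)))
   <= INR n * (27 * Cmod u ^ 3) * exp (INR n * (25 * Cmod u ^ 2)))%R.
Proof.
  intros Hu. assert (H0 := Cmod_ge_0 u).
  assert (He : (exp (Cmod u) <= 3)%R).
  { eapply Rle_trans; [|apply exp_le_3]. now apply exp_le_mono. }
  assert (Hp := exp_pos (Cmod u)).
  assert (Hcub : (0 <= Cmod u ^ 3)%R) by now apply pow_le.
  assert (Hc : (Cmod (ccosh u - (1 + u * u / 2)) <= 24 * Cmod u ^ 3)%R).
  { replace (ccosh u - (1 + u * u / 2)) with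
      (RtoC (/ 2) * ((cexp u - 1 - u - u * u / 2)
        + (cexp (- u) - 1 - - u - (- u) * (- u) / 2)))
      by (unfold ccosh; rewrite RtoC_inv by lra; field).
    rewrite Cmod_mult, Cmod_R, Rabs_pos_eq by lra.
    generalize (Cmod_triangle (cexp u - 1 - u - u * u / 2)
        (cexp (- u) - 1 - - u - (- u) * (- u) / 2)) (cexp_taylor2 u) (cexp_taylor2 (- u)).
    rewrite Cmod_opp. intros; nra. }
  assert (Huu : Cmod (u * u / 2) = (Cmod u ^ 2 / 2)%R).
  { unfold Cdiv. rewrite <- RtoC_inv by lra. rewrite !Cmod_mult, Cmod_R, Rabs_pos_eq by lra.
    field. }
  assert (Hsq : (0 <= Cmod u ^ 2 <= 1)%R) by nra.
  assert (H32 : (Cmod u ^ 3 <= Cmod u ^ 2)%R) by nra.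
  assert (H43 : (Cmod u ^ 4 <= Cmod u ^ 3)%R) by nra.
  assert (Hg : (Cmod (cexp (u * u / 2) - (1 + u * u / 2)) <= 3 * Cmod u ^ 3)%R).
  { replace (cexp (u * u / 2) - (1 + u * u / 2)) with (cexp (u * u / 2) - 1 - u * u / 2)
      by ring.
    eapply Rle_trans; [apply cexp_taylor1|]. rewrite Huu.
    assert (exp (Cmod u ^ 2 / 2) <= 3)%R.
    { eapply Rle_trans; [|apply exp_le_3]. apply exp_le_mono; lra. }
    generalize (exp_pos (Cmod u ^ 2 / 2)). nra. }
  pose (r := exp (25 * Cmod u ^ 2)).
  assert (Hr : (1 + 25 * Cmod u ^ 2 <= r)%R) by apply exp_ineq1_le.
  assert (Hbase : (Cmod (1 + u * u / 2) <= 1 + Cmod u ^ 2 / 2)%R).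
  { eapply Rle_trans; [apply Cmod_triangle|]. rewrite Huu, Cmod_1. lra. }
  assert (H1 : (Cmod (ccosh u) <= r)%R).
  { replace (ccosh u) with ((ccosh u - (1 + u * u / 2)) + (1 + u * u / 2)) by ring.
    eapply Rle_trans; [apply Cmod_triangle|]. lra. }
  assert (H2 : (Cmod (cexp (u * u / 2)) <= r)%R).
  { eapply Rle_trans; [apply Cmod_cexp_le|]. rewrite Huu. apply exp_le_mono; lra. }
  rewrite <- cexp_pow.
  eapply Rle_trans; [apply (Cmod_pow_sub_le _ _ r); auto; lra|].
  assert (Hrn : (r ^ n = exp (INR n * (25 * Cmod u ^ 2)))%R).
  { unfold r. clear. induction n as [|n IH]; [simpl; now rewrite Rmult_0_l, exp_0|].
    rewrite <- tech_pow_Rmult. rewrite S_INR, IH, <- exp_plus. f_equal; ring. }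
  rewrite Hrn. apply Rmult_le_compat_r; [left; apply exp_pos|].
  apply Rmult_le_compat_l; [apply pos_INR|].
  replace (ccosh u - cexp (u * u / 2)) with
    ((ccosh u - (1 + u * u / 2)) + - (cexp (u * u / 2) - (1 + u * u / 2))) by ring.
  eapply Rle_trans; [apply Cmod_triangle|]. rewrite Cmod_opp. lra.
Qed.

(** * Polya's finite identity *)

Lemma Binomial_C_0 (n : nat) : Binomial.C n 0 = 1%R.
Proof.
  unfold Binomial.C. rewrite Nat.sub_0_r. simpl. field. apply INR_fact_neq_0.
Qed.

Lemma Binomial_C_diag (n : nat) : Binomial.C n n = 1%R.
Proof.
  unfold Binomial.C. rewrite Nat.sub_diag. simpl. field. apply INR_fact_neq_0.
Qed.

Lemma Cpow_binomial (a b : C) (n : nat) :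
  (a + b) ^ n
  = csumn (fun k => RtoC (Binomial.C n k) * (a ^ k * b ^ (n - k))) (S n).
Proof.
  induction n as [|n IH].
  - simpl. rewrite Binomial_C_0. ring.
  - rewrite Cpow_S, IH, Cmult_plus_distr_r, <- !csumn_scal.
    set (A := fun k => a * (RtoC (Binomial.C n k) * (a ^ k * b ^ (n - k)))).
    set (B := fun k => b * (RtoC (Binomial.C n k) * (a ^ k * b ^ (n - k)))).
    set (G := fun k => RtoC (Binomial.C (S n) k) * (a ^ k * b ^ (S n - k))).
    (* Pascal's rule covers only the inner coefficients; [H0] and [Hn] are the two ends. *)
    assert (Hmid : forall k, (k < n)%nat -> G (S k) = A k + B (S k)).
    { intros k Hk. unfold A, B, G. rewrite <- pascal, RtoC_plus by exact Hk.
      replace (S n - S k)%nat with (n - k)%nat by lia.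
      replace (n - k)%nat with (S (n - S k)) by lia. rewrite !Cpow_S. ring. }
    assert (H0 : G O = B O).
    { unfold G, B. rewrite !Binomial_C_0, !Nat.sub_0_r, Cpow_S. ring. }
    assert (Hn : G (S n) = A n).
    { unfold G, A. rewrite !Binomial_C_diag, !Nat.sub_diag, Cpow_S. ring. }
    rewrite (csumn_first B), (csumn_first G).
    change (csumn A (S n)) with (csumn A n + A n).
    change (csumn (fun k => G (S k)) (S n)) with (csumn (fun k => G (S k)) n + G (S n)).
    rewrite (csumn_ext _ _ n Hmid), csumn_plus, H0, Hn. ring.
Qed.

Lemma geometric_csumn (x : C) (n : nat) :
  (x - 1) * csumn (fun k => x ^ k) n = x ^ n - 1.
Proof.
  induction n as [|n IH]; simpl; [ring|].
  rewrite Cmult_plus_distr_l, IH. ring.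
Qed.

(** The real part is [1 - 2 * sin (PI * r / l) ^ 2], which is below 1 because
    [0 < PI * r / l < PI]. *)
Lemma cexp_2PI_frac_neq_1 (r l : nat) :
  (0 < r < l)%nat -> cexp (Ci * RtoC (2 * PI * (INR r / INR l))) <> 1.
Proof.
  intros [Hr Hl] H.
  assert (H1 : (0 < INR r)%R) by now apply lt_0_INR.
  assert (H2 : (INR r < INR l)%R) by now apply lt_INR.
  assert (Hq : (0 < INR r / INR l < 1)%R).
  { split; [apply Rdiv_lt_0_compat; lra|]. apply Rmult_lt_reg_r with (INR l); [lra|].
    unfold Rdiv. rewrite Rmult_assoc, Rinv_l by lra. lra. }
  apply (f_equal Re) in H. unfold cexp in H. simpl in H.
  replace (0 * (2 * PI * (INR r / INR l)) - 1 * 0)%R with 0%R in H by ring.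
  replace (0 * 0 + 1 * (2 * PI * (INR r / INR l)))%R
    with (2 * (PI * (INR r / INR l)))%R in H by ring.
  rewrite exp_0, cos_2a_sin in H.
  assert (Hs : (0 < sin (PI * (INR r / INR l)))%R).
  { generalize PI_RGT_0; intros. apply sin_gt_0; nra. }
  nra.
Qed.

(** The window from [-h] to [h] is a complete residue system modulo [l = 2 h + 1]. Factoring out its
    first term leaves a geometric sum of ratio [x] with [x ^ l = 1], which vanishes unless
    [x = 1]. *)
Lemma roots_of_unity_sum (k h : nat) :
  zsumn (fun mu => cexp (Ci * RtoC (2 * PI * IZR mu * (INR k / INR (2 * h + 1))))) h
  = if (k mod (2 * h + 1) =? 0)%nat then RtoC (INR (2 * h + 1)) else 0.
Proof.
  set (l := (2 * h + 1)%nat).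
  assert (Hl : (0 < INR l)%R) by (apply lt_0_INR; unfold l; lia).
  pose (x := cexp (Ci * RtoC (2 * PI * (INR k / INR l)))).
  (* [y] is [x ^ (-h)], the term at the left end of the window. *)
  pose (y := cexp (- (RtoC (INR h) * (Ci * RtoC (2 * PI * (INR k / INR l)))))).
  assert (Hsum : zsumn (fun mu => cexp (Ci * RtoC (2 * PI * IZR mu * (INR k / INR l)))) h
                 = y * csumn (fun j => x ^ j) l).
  { unfold zsumn. fold l. rewrite <- csumn_scal. apply csumn_ext; intros j _.
    unfold x, y. rewrite cexp_pow, <- cexp_plus. f_equal.
    rewrite minus_IZR, <- !INR_IZR_INZ, !RtoC_mult, RtoC_minus. ring. }
  rewrite Hsum. clear Hsum.
  assert (Hx : x = cexp (Ci * RtoC (2 * PI * (INR (k mod l) / INR l)))).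
  { unfold x.
    assert (Hk : (INR k / INR l = INR (k mod l) / INR l + IZR (Z.of_nat (k / l)))%R).
    { rewrite <- INR_IZR_INZ. rewrite (Nat.div_mod_eq k l) at 1.
      rewrite plus_INR, mult_INR. field. lra. }
    rewrite Hk, Rmult_plus_distr_l, RtoC_plus, Cmult_plus_distr_l, cexp_plus, cexp_2PI_Z.
    ring. }
  destruct (Nat.eqb_spec (k mod l) 0) as [H0|H0].
  - assert (Hy : y = 1).
    { unfold y.
      replace (- (RtoC (INR h) * (Ci * RtoC (2 * PI * (INR k / INR l)))))
        with (Ci * RtoC (2 * PI * IZR (- Z.of_nat (h * (k / l))))); [apply cexp_2PI_Z|].
      rewrite opp_IZR, <- INR_IZR_INZ, mult_INR.
      replace (INR k / INR l)%R with (INR (k / l)).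
      - rewrite !RtoC_mult, RtoC_opp, RtoC_mult. ring.
      - rewrite (Nat.div_mod_eq k l) at 2. rewrite H0, Nat.add_0_r, mult_INR. field. lra. }
    rewrite H0 in Hx. simpl INR in Hx.
    replace (Ci * RtoC (2 * PI * (0 / INR l))) with (RtoC 0) in Hx.
    2: { unfold Rdiv. rewrite Rmult_0_l, Rmult_0_r. ring. }
    rewrite cexp_0 in Hx. rewrite Hx, Hy.
    clear. induction l as [|l IH]; [simpl; ring|].
    simpl csumn. rewrite Cmult_plus_distr_l, IH, Cpow_1_l, S_INR, RtoC_plus. ring.
  - assert (Hx1 : x <> 1).
    { rewrite Hx. apply cexp_2PI_frac_neq_1. split; [lia|].
      apply Nat.mod_upper_bound. unfold l; lia. }
    assert (Hxl : x ^ l = 1).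
    { unfold x. rewrite cexp_pow.
      replace (RtoC (INR l) * (Ci * RtoC (2 * PI * (INR k / INR l))))
        with (Ci * RtoC (2 * PI * IZR (Z.of_nat k))); [apply cexp_2PI_Z|].
      rewrite <- INR_IZR_INZ.
      replace (2 * PI * INR k)%R with (INR l * (2 * PI * (INR k / INR l)))%R by (field; lra).
      rewrite (RtoC_mult (INR l)). ring. }
    assert (Hg := geometric_csumn x l). rewrite Hxl in Hg.
    assert (Hz : csumn (fun j => x ^ j) l = 0).
    { destruct (Ceq_dec (csumn (fun j => x ^ j) l) 0) as [E|E]; [exact E|].
      exfalso. assert (Hx' : x - 1 <> 0) by (intros E'; apply Hx1;
        replace x with ((x - 1) + 1) by ring; rewrite E'; ring).
      apply (Cmult_neq_0 _ _ Hx' E). rewrite Hg. ring. }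
    rewrite Hz. ring.
Qed.

Lemma csumn_multiples (f : nat -> C) (l N : nat) :
  (0 < l)%nat ->
  csumn (fun k => if (k mod l =? 0)%nat then f k else 0) (l * N + 1)
  = csumn (fun p => f (l * p)%nat) (N + 1).
Proof.
  intros Hl. induction N as [|N IH].
  - rewrite Nat.mul_0_r. simpl. rewrite Nat.Div0.mod_0_l, Nat.mul_0_r. reflexivity.
  - replace (l * S N + 1)%nat with ((l * N + 1) + (l - 1) + 1)%nat by nia.
    rewrite (csumn_add _ (l * N + 1 + (l - 1)) 1), (csumn_add _ (l * N + 1) (l - 1)), IH.
    replace (S N + 1)%nat with (S (N + 1)) by lia. simpl csumn at 4.
    rewrite (csumn_ext _ (fun _ => 0) (l - 1)).
    2: { intros k Hk. replace (l * N + 1 + k)%nat with ((1 + k) + N * l)%nat by lia.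
         rewrite Nat.Div0.mod_add, Nat.mod_small by lia. reflexivity. }
    rewrite csumn_zero. simpl csumn at 2.
    replace (l * N + 1 + (l - 1) + 0)%nat with (l * (N + 1))%nat by nia.
    rewrite Nat.mul_comm at 1. rewrite Nat.Div0.mod_mul. simpl. ring.
Qed.

(** The exponential of index [k] in the expansion is [exp ((k / l - M) * (w + 2 pi i mu))]. Summing
    over [mu] leaves only [k = l * p], whose frequency [p - M] is an integer. *)
Lemma polya_identity (w : C) (h M : nat) :
  zsumn (fun mu => ccosh ((w + Ci * RtoC (2 * PI * IZR mu)) / RtoC (2 * INR (2 * h + 1)))
                   ^ (2 * ((2 * h + 1) * M))) h
  = csumn (fun p => RtoC (INR (2 * h + 1)
                          * (Binomial.C (2 * ((2 * h + 1) * M)) ((2 * h + 1) * p)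
                             / 4 ^ ((2 * h + 1) * M)))
                    * cexp (w * RtoC (INR p - INR M))) (2 * M + 1).
Proof.
  pose proof (roots_of_unity_sum) as Hroots.
  specialize (fun k => Hroots k h).
  set (l := (2 * h + 1)%nat) in *.
  assert (Hl : (0 < INR l)%R) by (apply lt_0_INR; unfold l; lia).
  assert (H4 : (4 ^ (l * M) <> 0)%R) by (apply pow_nonzero; lra).
  set (n := (2 * (l * M))%nat) in *.
  pose (g := fun k => RtoC (Binomial.C n k / 4 ^ (l * M))
                      * cexp (w * RtoC (INR k / INR l - INR M))).
  assert (Hterm : forall mu : Z,
    ccosh ((w + Ci * RtoC (2 * PI * IZR mu)) / RtoC (2 * INR l)) ^ n
    = csumn (fun k => g k * cexp (Ci * RtoC (2 * PI * IZR mu * (INR k / INR l)))) (S n)).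
  { intros mu. set (u := (w + Ci * RtoC (2 * PI * IZR mu)) / RtoC (2 * INR l)).
    replace (ccosh u) with (RtoC (/ 2) * (cexp u + cexp (- u))).
    2: { unfold ccosh. rewrite RtoC_inv by lra. field. }
    rewrite Cpow_mult_l, Cpow_binomial, <- csumn_scal.
    apply csumn_ext. intros k Hk. unfold g.
    rewrite !cexp_pow, <- cexp_plus, <- RtoC_pow.
    replace ((/ 2) ^ n)%R with (/ 4 ^ (l * M))%R.
    2: { unfold n. rewrite (pow_mult (/ 2) 2).
         replace ((/ 2) ^ 2)%R with (/ 4)%R by (simpl; field). now rewrite pow_inv. }
    unfold Rdiv at 1. rewrite RtoC_mult.
    assert (He : cexp (RtoC (INR k) * u + RtoC (INR (n - k)) * - u)
       = cexp (w * RtoC (INR k / INR l - INR M))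
         * cexp (Ci * RtoC (2 * PI * IZR mu * (INR k / INR l)))).
    { rewrite minus_INR by lia. unfold n. rewrite !mult_INR.
      replace (INR 2) with 2%R by (simpl; ring).
      (* The two exponents differ by [2 pi i mu M], a period of the exponential: this is where the
         exponent being a multiple of [2 * l] is used. *)
      rewrite <- cexp_plus, <- (Cmult_1_r (cexp (_ + Ci * _))).
      rewrite <- (cexp_2PI_Z (- (mu * Z.of_nat M))), <- cexp_plus. f_equal.
      rewrite opp_IZR, mult_IZR, <- INR_IZR_INZ. unfold u.
      rewrite !RtoC_mult, RtoC_opp, !RtoC_minus, !RtoC_mult, RtoC_div by lra.
      assert (RtoC (INR l) <> 0) by (intros E; apply RtoC_inj in E; lra).
      field. auto. }
    rewrite He. ring. }
  unfold zsumn at 1. fold l.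
  rewrite (csumn_ext _ (fun j => csumn (fun k => g k *
     cexp (Ci * RtoC (2 * PI * IZR (Z.of_nat j - Z.of_nat h) * (INR k / INR l)))) (S n)))
    by (intros; apply Hterm).
  rewrite csumn_swap.
  rewrite (csumn_ext _ (fun k => if (k mod l =? 0)%nat then RtoC (INR l) * g k else 0)).
  2: { intros k _. rewrite csumn_scal. unfold zsumn in Hroots. fold l in Hroots.
       rewrite Hroots. destruct (k mod l =? 0)%nat; ring. }
  replace (S n) with (l * (2 * M) + 1)%nat by (unfold n; lia).
  rewrite csumn_multiples by (unfold l; lia).
  apply csumn_ext; intros p _. unfold g.
  rewrite (RtoC_mult (INR l)).
  replace (INR (l * p) / INR l)%R with (INR p) by (rewrite mult_INR; field; lra).
  ring.
Qed.

(** * Asymptotics of the binomial coefficients *)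

Local Open Scope R_scope.

Definition central_binom (m : nat) : R := Binomial.C (2 * m) m / 4 ^ m.

Lemma Binomial_C_pos (n k : nat) : 0 < Binomial.C n k.
Proof.
  apply Rdiv_lt_0_compat; [|apply Rmult_lt_0_compat]; apply INR_fact_lt_0.
Qed.

Lemma central_binom_S (m : nat) :
  central_binom (S m) = central_binom m * ((2 * INR m + 1) / (2 * INR m + 2)).
Proof.
  unfold central_binom, Binomial.C.
  replace (2 * S m - S m)%nat with (S m) by lia.
  replace (2 * m - m)%nat with m by lia.
  replace (2 * S m)%nat with (S (S (2 * m))) by lia.
  rewrite !fact_simpl, !mult_INR, !S_INR, mult_INR. simpl pow. simpl (INR 2).
  generalize (INR_fact_neq_0 m) (INR_fact_neq_0 (2 * m)) (pos_INR m) (pow_nonzero 4 m).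
  intros H1 H2 H3 H4. assert (H5 : 4 ^ m <> 0) by (apply H4; lra).
  field. repeat split; auto; lra.
Qed.

Lemma central_binom_pos (m : nat) : 0 < central_binom m.
Proof.
  apply Rdiv_lt_0_compat; [apply Binomial_C_pos | apply pow_lt; lra].
Qed.

(* The Wallis limit; its value need not be known. *)
Lemma central_binom_sqr_lim :
  exists K : R, 0 <= K /\ is_lim_seq (fun m => central_binom m ^ 2 * (INR m + / 2)) K.
Proof.
  (* The shift [1/2] makes the sequence decreasing, so the trivial lower bound 0 gives convergence;
     without it the sequence would increase and call for an upper bound. *)
  destruct (ex_finite_lim_seq_decr (fun m => central_binom m ^ 2 * (INR m + / 2)) 0)
    as [K HK].
  - intros m. rewrite central_binom_S, S_INR.
    generalize (pos_INR m) (central_binom_pos m); intros Hm Hc.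
    replace ((central_binom m * ((2 * INR m + 1) / (2 * INR m + 2))) ^ 2 * (INR m + 1 + / 2))
      with (central_binom m ^ 2 * (((2 * INR m + 1) / (2 * INR m + 2)) ^ 2 * (INR m + 1 + / 2)))
      by ring.
    apply Rmult_le_compat_l; [apply pow2_ge_0|].
    replace (INR m + / 2) with
      (((2 * INR m + 1) / (2 * INR m + 2)) ^ 2 * (INR m + 1 + / 2)
       + (INR m + / 2) / (2 * INR m + 2) ^ 2) by (field; lra).
    assert (0 < (INR m + / 2) / (2 * INR m + 2) ^ 2)
      by (apply Rdiv_lt_0_compat; [lra | apply pow_lt; lra]).
    lra.
  - intros m. apply Rmult_le_pos; [apply pow2_ge_0 | generalize (pos_INR m); lra].
  - exists K. split; [|exact HK].
    apply (is_lim_seq_le (fun _ => 0) (fun m => central_binom m ^ 2 * (INR m + / 2)) 0 K);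
      [|apply is_lim_seq_const | exact HK].
    intros m. apply Rmult_le_pos; [apply pow2_ge_0 | generalize (pos_INR m); lra].
Qed.

Lemma Binomial_C_shift_S (m j : nat) :
  (j < m)%nat ->
  Binomial.C (2 * m) (m + S j)
  = Binomial.C (2 * m) (m + j) * ((INR m - INR j) / (INR m + INR j + 1)).
Proof.
  intros Hj. unfold Binomial.C.
  replace (2 * m - (m + j))%nat with (S (m - S j)) by lia.
  replace (2 * m - (m + S j))%nat with (m - S j)%nat by lia.
  replace (m + S j)%nat with (S (m + j)) by lia.
  rewrite !fact_simpl, !mult_INR, !S_INR, minus_INR, plus_INR, S_INR by lia.
  generalize (INR_fact_neq_0 (m + j)) (INR_fact_neq_0 (m - S j)) (pos_INR m) (pos_INR j)
    (lt_INR j m Hj).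
  intros H1 H2 H3 H4 H5. field. repeat split; auto; lra.
Qed.

(** The quotient by the central coefficient is the product over [i < j] of [(m - i) / (m + i + 1)].
    A factor equals [1 - (2i+1)/(m+i+1)] and its inverse [1 + (2i+1)/(m-i)]; [1 + x <= exp x]
    applies to both, and the odd numbers [2i+1] add up to [j^2]. The fixed [J] replaces [i] in the
    denominators so that the exponents can be added. *)
Lemma Binomial_C_shift_bounds (m J : nat) :
  (J <= m)%nat -> forall j, (j <= J)%nat ->
  Binomial.C (2 * m) m * exp (- (INR j ^ 2 / (INR m - INR J + 1)))
    <= Binomial.C (2 * m) (m + j)
    <= Binomial.C (2 * m) m * exp (- (INR j ^ 2 / (INR m + INR J))).
Proof.
  intros HJ j. induction j as [|j IH]; intros Hj.
  - simpl INR. rewrite Nat.add_0_r.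
    unfold Rdiv. rewrite !pow_i, !Rmult_0_l, !Ropp_0, exp_0 by lia. lra.
  - destruct IH as [IH1 IH2]; [lia|].
    rewrite Binomial_C_shift_S by lia.
    assert (Hc := Binomial_C_pos (2 * m) (m + j)). assert (Hc0 := Binomial_C_pos (2 * m) m).
    assert (H0 := pos_INR j). assert (H1 : INR (S j) <= INR J) by (apply le_INR; lia).
    rewrite S_INR in H1 |- *. assert (H2 : INR J <= INR m) by (apply le_INR; lia).
    assert (Hq : 0 < (INR m - INR j) / (INR m + INR j + 1)) by (apply Rdiv_lt_0_compat; lra).
    assert (Hinv : forall x y, 0 < x -> x <= y -> / y <= / x)
      by (intros; apply Rinv_le_contravar; lra).
    split.
    + replace (- ((INR j + 1) ^ 2 / (INR m - INR J + 1)))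
        with (- (INR j ^ 2 / (INR m - INR J + 1))
              + - ((2 * INR j + 1) / (INR m - INR J + 1))) by (field; lra).
      rewrite exp_plus, <- Rmult_assoc.
      apply Rmult_le_compat; try exact IH1; try (left; apply exp_pos).
      { apply Rmult_le_pos; [lra | left; apply exp_pos]. }
      assert (He : 1 + (2 * INR j + 1) / (INR m - INR j)
                   <= exp ((2 * INR j + 1) / (INR m - INR J + 1))).
      { eapply Rle_trans; [apply exp_ineq1_le|]. apply exp_le_mono.
        apply Rmult_le_compat_l; [lra|]. apply Hinv; lra. }
      rewrite exp_Ropp.
      replace ((INR m - INR j) / (INR m + INR j + 1))
        with (/ (1 + (2 * INR j + 1) / (INR m - INR j))) by (field; lra).
      apply Hinv; [|exact He].
      assert (0 < (2 * INR j + 1) / (INR m - INR j)) by (apply Rdiv_lt_0_compat; lra). lra.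
    + replace (- ((INR j + 1) ^ 2 / (INR m + INR J)))
        with (- (INR j ^ 2 / (INR m + INR J)) + - ((2 * INR j + 1) / (INR m + INR J)))
        by (field; lra).
      rewrite exp_plus, <- Rmult_assoc.
      apply Rmult_le_compat; try exact IH2; try lra.
      replace ((INR m - INR j) / (INR m + INR j + 1))
        with (1 + - ((2 * INR j + 1) / (INR m + INR j + 1))) by (field; lra).
      eapply Rle_trans; [apply exp_ineq1_le|]. apply exp_le_mono.
      apply Ropp_le_contravar. apply Rmult_le_compat_l; [lra|]. apply Hinv; lra.
Qed.

(** Completing the square; the source of the bounds by [exp (-|n|)] for all the Gaussian series
    below. *)
Lemma gaussian_le_exp (c d x : R) :
  0 < c -> - (c * x ^ 2) + d * x <= (d + 1) ^ 2 / (4 * c) - x.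
Proof.
  intros Hc.
  assert (0 <= (2 * c * x - (d + 1)) ^ 2 / (4 * c))
    by (apply Rmult_le_pos; [apply pow2_ge_0 | left; apply Rinv_0_lt_compat; lra]).
  replace ((d + 1) ^ 2 / (4 * c) - x) with
    ((2 * c * x - (d + 1)) ^ 2 / (4 * c) + (- (c * x ^ 2) + d * x)) by (field; lra).
  lra.
Qed.

(** * Scaling limit of the binomial coefficients *)

Section Scaling.

Context (tau : R) (Htau : 0 < tau) (M : nat -> nat).
Let L (h : nat) : R := INR (2 * h + 1).
Context (HM : is_lim_seq (fun h => INR (M h) / L h) (/ tau)).

Lemma scale_pos (h : nat) : 0 < L h.
Proof. apply lt_0_INR; lia. Qed.

Lemma scale_inv_lim : is_lim_seq (fun h => / L h) 0.
Proof.
  replace (Finite 0) with (Rbar_inv p_infty) by reflexivity.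
  apply is_lim_seq_inv; [|discriminate].
  apply (is_lim_seq_le_p_loc INR); [|apply is_lim_seq_INR].
  exists O. intros h _. apply le_INR; lia.
Qed.

Lemma scale_ge (x : R) : eventually (fun h => x <= L h).
Proof.
  destruct (INR_unbounded x) as [N HN]. exists N. intros h Hh.
  assert (INR N <= L h) by (apply le_INR; lia). lra.
Qed.

Lemma ratio_bounds :
  eventually (fun h => / (2 * tau) <= INR (M h) / L h <= 2 / tau).
Proof.
  assert (Hi : 0 < / tau) by now apply Rinv_0_lt_compat.
  assert (He : 0 < / tau / 2) by lra.
  generalize (proj2 (is_lim_seq_spec _ _) HM (mkposreal _ He)).
  apply filter_imp; intros h Hh. simpl in Hh. apply Rabs_def2 in Hh.
  rewrite Rinv_mult. unfold Rdiv in *. lra.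
Qed.

Lemma scale_M_lim : filterlim M eventually eventually.
Proof.
  intros P [N HN]. change (eventually (fun h => P (M h))).
  generalize (filter_and _ _ ratio_bounds (scale_ge (2 * tau * INR N))).
  apply filter_imp; intros h [[H1 _] H2].
  assert (HL := scale_pos h). apply HN, INR_le.
  apply (Rmult_le_compat_r (L h)) in H1; [|lra].
  replace (INR (M h) / L h * L h) with (INR (M h)) in H1 by (field; lra).
  apply Rmult_le_reg_l with (2 * tau); [lra|].
  apply (Rmult_le_compat_l (2 * tau)) in H1; [|lra].
  rewrite <- Rmult_assoc, Rinv_r in H1 by lra. lra.
Qed.

(** The lower-order terms [c1] and [c2] accommodate, with [m = l * M], both [m + 1/2] from the
    Wallis factor and the denominators near [m] in the binomial bounds. *)
Lemma scale_rational_lim (c1 c2 : R) :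
  is_lim_seq (fun h => L h ^ 2 / (L h * INR (M h) + c1 * L h + c2)) tau.
Proof.
  assert (Hi : / tau <> 0) by (apply Rgt_not_eq, Rinv_0_lt_compat; lra).
  apply is_lim_seq_ext with (fun h => / (INR (M h) / L h + c1 * / L h + c2 * (/ L h * / L h))).
  { intros h. assert (HL := scale_pos h).
    replace (INR (M h) / L h + c1 * / L h + c2 * (/ L h * / L h))
      with ((L h * INR (M h) + c1 * L h + c2) / L h ^ 2) by (field; lra).
    unfold Rdiv. rewrite Rinv_mult, Rinv_inv. ring. }
  replace tau with (/ / tau) by apply Rinv_inv.
  apply (is_lim_seq_inv _ (/ tau)); [|now intros E; injection E].
  replace (Finite (/ tau)) with (Finite (/ tau + c1 * 0 + c2 * (0 * 0))) by (f_equal; ring).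
  apply is_lim_seq_plus'; [apply is_lim_seq_plus'|].
  - exact HM.
  - apply (is_lim_seq_scal_l _ c1 0), scale_inv_lim.
  - apply (is_lim_seq_scal_l _ c2 (0 * 0)). apply is_lim_seq_mult'; apply scale_inv_lim.
Qed.

(** The coefficient of [exp (w q)] on the right of Polya's identity. By symmetry of the binomial
    coefficients [|q|] may stand for [q], which keeps the lower index free of truncated
    subtraction. *)
Definition theta_coef (h : nat) (q : Z) : R :=
  L h * (Binomial.C (2 * ((2 * h + 1) * M h))
           ((2 * h + 1) * M h + (2 * h + 1) * Z.to_nat (Z.abs q))
         / 4 ^ ((2 * h + 1) * M h)).

Lemma scaled_central_binom_lim (K : R) :
  is_lim_seq (fun m => central_binom m ^ 2 * (INR m + / 2)) K ->
  is_lim_seq (fun h => L h * central_binom ((2 * h + 1) * M h)) (sqrt (K * tau)).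
Proof.
  intros HK.
  (* The square of the sequence is the Wallis sequence at [m = l * M] times [l^2 / (m + 1/2)], with
     limits [K] and [tau]. *)
  apply is_lim_seq_ext with
    (fun h => sqrt (central_binom ((2 * h + 1) * M h) ^ 2
                      * (INR ((2 * h + 1) * M h) + / 2)
                    * (L h ^ 2 / (L h * INR (M h) + 0 * L h + / 2)))).
  { intros h. assert (HL := scale_pos h). assert (HMp := pos_INR (M h)).
    assert (Hc := central_binom_pos ((2 * h + 1) * M h)).
    rewrite mult_INR. fold (L h).
    replace (central_binom ((2 * h + 1) * M h) ^ 2 * (L h * INR (M h) + / 2) *
       (L h ^ 2 / (L h * INR (M h) + 0 * L h + / 2)))
      with (Rsqr (L h * central_binom ((2 * h + 1) * M h))).
    - apply sqrt_Rsqr. apply Rmult_le_pos; lra.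
    - unfold Rsqr. field. nra. }
  apply is_lim_seq_continuous; [apply continuity_pt_filterlim, continuous_sqrt|].
  apply is_lim_seq_mult'; [|apply scale_rational_lim].
  apply (is_lim_seq_subseq (fun m => central_binom m ^ 2 * (INR m + / 2)) K
    (fun h => ((2 * h + 1) * M h)%nat)); [|exact HK].
  intros P [N HN].
  destruct (scale_M_lim (fun n => (N <= n)%nat)) as [h0 H0]; [now exists N|].
  exists h0. intros h Hh. apply HN. specialize (H0 h Hh). cbv beta in H0. nia.
Qed.

Lemma theta_coef_bounds (h : nat) (q : Z) :
  (Z.abs q <= Z.of_nat (M h))%Z ->
  let c := L h * central_binom ((2 * h + 1) * M h) in
  let a := Rabs (IZR q) in
  c * exp (- (a ^ 2 * (L h ^ 2 / (L h * INR (M h) + - a * L h + 1))))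
    <= theta_coef h q
    <= c * exp (- (a ^ 2 * (L h ^ 2 / (L h * INR (M h) + a * L h + 0)))).
Proof.
  intros Hq c a.
  assert (HL := scale_pos h).
  assert (Ha : a = INR (Z.to_nat (Z.abs q))).
  { unfold a. rewrite <- abs_IZR, INR_IZR_INZ, Z2Nat.id by lia. reflexivity. }
  destruct (Binomial_C_shift_bounds ((2 * h + 1) * M h)
    ((2 * h + 1) * Z.to_nat (Z.abs q)) ltac:(nia)
    ((2 * h + 1) * Z.to_nat (Z.abs q)) (le_n _)) as [H1 H2].
  rewrite !mult_INR, <- Ha in H1, H2. fold (L h) in H1, H2.
  replace ((L h * a) ^ 2 / (L h * INR (M h) - L h * a + 1))
    with (a ^ 2 * (L h ^ 2 / (L h * INR (M h) + - a * L h + 1))) in H1.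
  2: { unfold Rdiv. replace (L h * INR (M h) - L h * a + 1)
         with (L h * INR (M h) + - a * L h + 1) by ring. ring. }
  replace ((L h * a) ^ 2 / (L h * INR (M h) + L h * a))
    with (a ^ 2 * (L h ^ 2 / (L h * INR (M h) + a * L h + 0))) in H2.
  2: { unfold Rdiv. replace (L h * INR (M h) + L h * a)
         with (L h * INR (M h) + a * L h + 0) by ring. ring. }
  assert (H4 : 0 < 4 ^ ((2 * h + 1) * M h)) by (apply pow_lt; lra).
  assert (Hf : 0 < L h / 4 ^ ((2 * h + 1) * M h)) by now apply Rdiv_lt_0_compat.
  apply (Rmult_le_compat_l (L h / 4 ^ ((2 * h + 1) * M h))) in H1; [|lra].
  apply (Rmult_le_compat_l (L h / 4 ^ ((2 * h + 1) * M h))) in H2; [|lra].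
  unfold theta_coef, c, central_binom.
  split; eapply Rle_trans; [|eapply Rle_trans; [exact H1|] | |eapply Rle_trans; [exact H2|]];
    right; unfold Rdiv; ring.
Qed.

Lemma theta_coef_lim (K : R) (q : Z) :
  is_lim_seq (fun m => central_binom m ^ 2 * (INR m + / 2)) K ->
  is_lim_seq (fun h => theta_coef h q) (sqrt (K * tau) * exp (- (IZR q ^ 2 * tau))).
Proof.
  intros HK.
  rewrite <- (pow2_abs (IZR q)). set (a := Rabs (IZR q)).
  assert (Hexp : forall c1 c2, is_lim_seq
    (fun h => L h * central_binom ((2 * h + 1) * M h)
              * exp (- (a ^ 2 * (L h ^ 2 / (L h * INR (M h) + c1 * L h + c2)))))
    (sqrt (K * tau) * exp (- (a ^ 2 * tau)))).
  { intros c1 c2. apply is_lim_seq_mult'; [now apply scaled_central_binom_lim|].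
    apply is_lim_seq_continuous; [apply continuity_pt_filterlim, continuous_exp|].
    refine (proj1 (is_lim_seq_opp _ (a ^ 2 * tau)) _).
    apply (is_lim_seq_scal_l _ (a ^ 2) tau), scale_rational_lim. }
  eapply is_lim_seq_le_le_loc; [|apply (Hexp (- a) 1) | apply (Hexp a 0)].
  destruct (scale_M_lim (fun n => (Z.to_nat (Z.abs q) <= n)%nat)) as [h0 H0];
    [now exists (Z.to_nat (Z.abs q))|].
  exists h0. intros h Hh. specialize (H0 h Hh). cbv beta in H0.
  apply theta_coef_bounds. lia.
Qed.

Lemma theta_coef_dominated (K d : R) :
  is_lim_seq (fun m => central_binom m ^ 2 * (INR m + / 2)) K -> 0 <= d ->
  exists B, eventually (fun h => forall q, (Z.abs q <= Z.of_nat (M h))%Z ->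
    theta_coef h q * exp (d * Rabs (IZR q)) <= B * exp (- Rabs (IZR q))).
Proof.
  intros HK Hd.
  pose (S := sqrt (K * tau) + 1).
  exists (S * exp ((d + 1) ^ 2 / (4 * (tau / 4)))).
  generalize (proj2 (is_lim_seq_spec _ _) (scaled_central_binom_lim K HK) (mkposreal 1 Rlt_0_1)).
  intros HS. generalize (filter_and _ _ HS ratio_bounds).
  apply filter_imp; intros h [H1 H2] q Hq.
  cbn [pos] in H1. apply Rabs_def2 in H1. destruct H1 as [H1 _].
  destruct (theta_coef_bounds h q Hq) as [_ H3].
  set (a := Rabs (IZR q)) in *.
  assert (HL := scale_pos h). assert (HMp := pos_INR (M h)).
  assert (Ha : 0 <= a) by apply Rabs_pos.
  assert (HaM : a <= INR (M h)).
  { unfold a. rewrite <- abs_IZR, INR_IZR_INZ. now apply IZR_le. }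
  assert (Hc : 0 <= L h * central_binom ((2 * h + 1) * M h)).
  { apply Rmult_le_pos; [lra | left; apply central_binom_pos]. }
  (* Inside the window [a <= M], so the denominator is at most [2 * l * M], and [M / l <= 2 / tau]
     yields the rate [tau / 4], uniform in [h]. The case [a = 0] is separated to have a visibly
     positive denominator. *)
  assert (Hx : tau / 4 * a ^ 2 <= a ^ 2 * (L h ^ 2 / (L h * INR (M h) + a * L h + 0))).
  { destruct (Req_dec a 0) as [->|Ha0]; [right; ring|].
    rewrite Rmult_comm. apply Rmult_le_compat_l; [apply pow2_ge_0|].
    apply Rmult_le_reg_r with (L h * INR (M h) + a * L h + 0); [nra|].
    replace (L h ^ 2 / (L h * INR (M h) + a * L h + 0) * (L h * INR (M h) + a * L h + 0))
      with (L h ^ 2) by (field; nra).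
    destruct H2 as [_ H2].
    apply (Rmult_le_compat_r (tau * L h)) in H2; [|nra].
    replace (INR (M h) / L h * (tau * L h)) with (tau * INR (M h)) in H2 by (field; lra).
    replace (2 / tau * (tau * L h)) with (2 * L h) in H2 by (field; lra).
    assert (H5 : tau * (INR (M h) + a) <= 4 * L h) by nra.
    replace (tau / 4 * (L h * INR (M h) + a * L h + 0))
      with (L h / 4 * (tau * (INR (M h) + a))) by field.
    nra. }
  eapply Rle_trans; [apply Rmult_le_compat_r; [left; apply exp_pos | exact H3]|].
  set (c := L h * central_binom ((2 * h + 1) * M h)) in *.
  rewrite Rmult_assoc, <- exp_plus, Rmult_assoc, <- exp_plus.
  apply Rmult_le_compat; [exact Hc | left; apply exp_pos | unfold S; lra |].
  apply exp_le_mono. generalize (gaussian_le_exp (tau / 4) d a). intros Hg.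
  assert (0 < tau / 4) by lra. specialize (Hg H). lra.
Qed.

End Scaling.

(** * The theta formula *)

Lemma sinh_sqr_le (a : R) : Rabs a <= / 2 -> sinh a ^ 2 <= 4 * a ^ 2.
Proof.
  assert (Hpos : forall a, 0 <= a <= / 2 -> sinh a ^ 2 <= 4 * a ^ 2).
  { clear a. intros a Ha. unfold sinh.
    assert (H1 := exp_ineq1_le (- a)). assert (H2 := exp_ineq1_le a).
    assert (H3 : exp a <= 1 + 2 * a).
    { rewrite <- (Ropp_involutive a), exp_Ropp.
      apply Rle_trans with (/ (1 + - a)); [apply Rinv_le_contravar; lra|].
      rewrite Ropp_involutive. apply Rmult_le_reg_r with (1 + - a); [lra|].
      rewrite Rinv_l by lra. nra. }
    assert (H4 : exp (- a) <= 1) by (rewrite <- exp_0; apply exp_le_mono; lra).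
    replace (4 * a ^ 2) with ((2 * a) ^ 2) by ring.
    apply pow_incr. lra. }
  intros Ha. destruct (Rle_dec 0 a) as [H|H].
  - rewrite Rabs_pos_eq in Ha by lra. apply Hpos; lra.
  - rewrite Rabs_left in Ha by lra.
    replace (a ^ 2) with ((- a) ^ 2) by ring.
    replace (sinh a ^ 2) with (sinh (- a) ^ 2); [apply Hpos; lra|].
    unfold sinh. rewrite Ropp_involutive. field.
Qed.

(** The upper bound is a partial sum of the Leibniz series. It yields the range
    [22 / 10 = 1/2 + 3.4 / 2] for the imaginary part: [1/2] for the contribution of [w], [PI / 2]
    for that of the residue. *)
Lemma PI_bounds : 3 < PI < 34 / 10.
Proof.
  split; [generalize PI2_3_2; unfold PI2; lra|].
  generalize (proj2 (PI_ineq 2)). unfold tg_alt, PI_tg. simpl. lra.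
Qed.

(** [sin b >= b - b^3 / 6], and [1 - b^2 / 6 >= 1/6] as long as [b <= 2.2]; hence [36 = 6^2]. *)
Lemma sin_sqr_ge (b : R) : Rabs b <= 22 / 10 -> b ^ 2 / 36 <= sin b ^ 2.
Proof.
  assert (Hpos : forall b, 0 <= b <= 22 / 10 -> b ^ 2 / 36 <= sin b ^ 2).
  { clear b. intros b Hb. generalize PI_bounds; intros HPI.
    destruct (sin_bound b 0) as [H _]; try lra.
    unfold sin_approx, sin_term in H. simpl in H.
    assert (H1 : b / 6 <= sin b) by nra.
    replace (b ^ 2 / 36) with ((b / 6) ^ 2) by field.
    apply pow_incr. lra. }
  intros Hb. destruct (Rle_dec 0 b) as [H|H].
  - rewrite Rabs_pos_eq in Hb by lra. apply Hpos; lra.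
  - rewrite Rabs_left in Hb by lra.
    replace (b ^ 2) with ((- b) ^ 2) by ring.
    replace (sin b ^ 2) with (sin (- b) ^ 2); [apply Hpos; lra|].
    rewrite sin_neg. ring.
Qed.

(** [|cosh (a + i b)|^2 = 1 + sinh a ^ 2 - sin b ^ 2], followed by [1 + x <= exp x]. *)
Lemma Cmod_ccosh_pow_le (a b : R) (m : nat) :
  Rabs a <= / 2 -> Rabs b <= 22 / 10 ->
  Cmod (ccosh (a, b) ^ (2 * m)) <= exp (INR m * (4 * a ^ 2 - b ^ 2 / 36)).
Proof.
  intros Ha Hb. rewrite Cmod_pow, pow_mult.
  assert (H : Cmod (ccosh (a, b)) ^ 2 <= exp (4 * a ^ 2 - b ^ 2 / 36)).
  { rewrite Cmod2_alt.
    replace (ccosh (a, b)) with (cosh a * cos b, sinh a * sin b).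
    2: { unfold ccosh, cexp, cosh, sinh. apply injective_projections; simpl;
           rewrite cos_neg, sin_neg; field. }
    simpl Re; simpl Im.
    generalize (sinh_sqr_le a Ha) (sin_sqr_ge b Hb); intros H1 H2.
    assert (Hc : cosh a ^ 2 = 1 + sinh a ^ 2).
    { unfold cosh, sinh. assert (H := exp_plus a (- a)).
      rewrite Rplus_opp_r, exp_0 in H.
      replace (((exp a + exp (- a)) / 2) ^ 2) with
        (exp a * exp (- a) + ((exp a - exp (- a)) / 2) ^ 2) by field. lra. }
    assert (Ht := sin2_cos2 b). unfold Rsqr in Ht.
    rewrite !Rpow_mult_distr, Hc.
    replace ((1 + sinh a ^ 2) * cos b ^ 2 + sinh a ^ 2 * sin b ^ 2)
      with (1 * (cos b * cos b) + sinh a ^ 2 * (sin b * sin b + cos b * cos b)) by ring.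
    replace (cos b * cos b) with (1 - sin b ^ 2) at 1 by (simpl; lra).
    rewrite Ht.
    eapply Rle_trans; [|apply exp_ineq1_le]. lra. }
  eapply Rle_trans.
  - apply pow_incr. split; [|exact H]. apply pow_le, Cmod_ge_0.
  - right. clear. induction m as [|m IH]; [simpl; now rewrite Rmult_0_l, exp_0|].
    rewrite <- tech_pow_Rmult, S_INR, IH, <- exp_plus. f_equal; ring.
Qed.

(** * Scaling limit of the powers of cosh *)

Section Scaling.

Context (tau : R) (Htau : 0 < tau) (M : nat -> nat).
Let L (h : nat) : R := INR (2 * h + 1).
Context (HM : is_lim_seq (fun h => INR (M h) / L h) (/ tau)).

Lemma ccosh_pow_lim (xi : C) :
  Clim eventually (fun h => ccosh (xi / RtoC (2 * L h)) ^ (2 * ((2 * h + 1) * M h)))%C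
    (cexp (xi * xi / RtoC (4 * tau))).
Proof.
  assert (Hexp : Clim eventually
    (fun h => cexp (RtoC (INR (M h) / L h) * (xi * xi / 4)))%C
    (cexp (xi * xi / RtoC (4 * tau)))).
  { apply Clim_cexp.
    replace (xi * xi / RtoC (4 * tau))%C with (RtoC (/ tau) * (xi * xi / 4))%C.
    - apply Clim_mult; [|apply Clim_const]. apply Clim_RtoC. exact HM.
    - rewrite RtoC_inv, RtoC_mult by lra. field.
      intros E; apply RtoC_inj in E; lra. }
  assert (Hd : Clim eventually
    (fun h => ccosh (xi / RtoC (2 * L h)) ^ (2 * ((2 * h + 1) * M h))
              - cexp (RtoC (INR (M h) / L h) * (xi * xi / 4)))%C 0%C).
  { intros eps He.
    pose (x := Cmod xi). assert (Hx : 0 <= x) by apply Cmod_ge_0.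
    (* [ccosh_pow_approx] at [u = xi / (2 l)] with exponent [2 l M] has error
       [27 r x^3 / 4 * exp (25 r x^2 / 2) / l], where [r = M / l]; [K] replaces [r] by its bound
       [2 / tau]. *)
    pose (K := 27 * (2 / tau) * x ^ 3 / 4 * exp (25 * (2 / tau) * x ^ 2 / 2)).
    assert (Ht : 0 < 2 / tau) by (apply Rdiv_lt_0_compat; lra).
    generalize (filter_and _ _ (ratio_bounds tau Htau M HM)
      (filter_and _ _ (scale_ge x) (scale_ge (K / eps + 1)))).
    apply filter_imp; intros h [[_ H1] [H2 H3]]. fold (L h) in *.
    assert (HL := scale_pos h : 0 < L h). assert (HMp := pos_INR (M h)).
    assert (Hr : 0 <= INR (M h) / L h)
      by (apply Rmult_le_pos; [lra | left; now apply Rinv_0_lt_compat]).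
    set (r := INR (M h) / L h) in *.
    assert (HLC : RtoC (L h) <> 0%C) by (intros E; apply RtoC_inj in E; lra).
    assert (Hu : Cmod (xi / RtoC (2 * L h)) = x / (2 * L h)).
    { rewrite Cmod_div, Cmod_R, Rabs_pos_eq; [reflexivity | lra |].
      intros E; apply RtoC_inj in E; lra. }
    assert (Hu1 : Cmod (xi / RtoC (2 * L h)) <= 1).
    { rewrite Hu. apply Rmult_le_reg_r with (2 * L h); [lra|].
      unfold Rdiv. rewrite Rmult_assoc, Rinv_l by lra. lra. }
    generalize (ccosh_pow_approx _ (2 * ((2 * h + 1) * M h)) Hu1).
    rewrite Hu, !mult_INR. fold (L h).
    replace (INR 2) with 2 by (simpl; ring).
    replace (2 * (L h * INR (M h)) * (27 * (x / (2 * L h)) ^ 3))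
      with (27 * r * x ^ 3 / 4 * / L h) by (unfold r; field; lra).
    replace (2 * (L h * INR (M h)) * (25 * (x / (2 * L h)) ^ 2))
      with (25 * r * x ^ 2 / 2) by (unfold r; field; lra).
    replace (RtoC (2 * (L h * INR (M h))) * (xi / RtoC (2 * L h) * (xi / RtoC (2 * L h)) / 2))%C
      with (RtoC r * (xi * xi / 4))%C.
    2: { unfold r. rewrite RtoC_div, !RtoC_mult by lra. field. exact HLC. }
    intros H4. unfold Cminus at 1. rewrite Copp_0, Cplus_0_r.
    eapply Rle_lt_trans; [exact H4|]. clear H4.
    assert (Hx3 : 0 <= x ^ 3) by now apply pow_le.
    assert (Hx2 : 0 <= x ^ 2) by now apply pow_le.
    apply Rle_lt_trans with (K * / L h).
    - unfold K.
      replace (27 * r * x ^ 3 / 4 * / L h * exp (25 * r * x ^ 2 / 2))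
        with (27 * r * x ^ 3 / 4 * exp (25 * r * x ^ 2 / 2) * / L h) by ring.
      apply Rmult_le_compat_r; [left; now apply Rinv_0_lt_compat|].
      apply Rmult_le_compat; [nra | left; apply exp_pos | nra |].
      apply exp_le_mono. nra.
    - apply Rmult_lt_reg_r with (L h); [exact HL|].
      rewrite Rmult_assoc, Rinv_l, Rmult_1_r by lra.
      apply Rlt_le_trans with (eps * (K / eps + 1)); [|now apply Rmult_le_compat_l; lra].
      replace (eps * (K / eps + 1)) with (K + eps) by (field; lra). lra. }
  generalize (Clim_plus _ _ _ _ Hd Hexp). rewrite Cplus_0_l.
  apply Clim_ext. apply filter_forall; intros h. ring.
Qed.

Lemma ccosh_pow_dominated (w : C) :
  exists B, eventually (fun h => forall mu, (Z.abs mu <= Z.of_nat h)%Z ->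
    Cmod (ccosh ((w + Ci * RtoC (2 * PI * IZR mu)) / RtoC (2 * L h))
            ^ (2 * ((2 * h + 1) * M h)))%C
      <= B * exp (- Rabs (IZR mu))).
Proof.
  destruct w as [p q].
  exists (exp (2 / tau * (p ^ 2 + q ^ 2) + 4 * tau)).
  generalize (filter_and _ _ (ratio_bounds tau Htau M HM)
    (filter_and _ _ (scale_ge (Rabs p)) (scale_ge (Rabs q)))).
  apply filter_imp; intros h [[H0 H1] [H2 H3]] mu Hmu. fold (L h) in *.
  assert (HL := scale_pos h : 0 < L h). assert (HMp := pos_INR (M h)).
  assert (HiL : 0 < / L h) by now apply Rinv_0_lt_compat.
  assert (HPI := PI_bounds).
  set (v := IZR mu).
  assert (Hv : Rabs v <= L h / 2).
  { unfold v, L. rewrite plus_INR, mult_INR. simpl INR. rewrite <- abs_IZR.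
    apply IZR_le in Hmu. rewrite <- INR_IZR_INZ in Hmu. lra. }
  replace (((p, q) + Ci * RtoC (2 * PI * v)) / RtoC (2 * L h))%C
    with (p / (2 * L h), (q + 2 * PI * v) / (2 * L h)).
  2: { unfold Cdiv. rewrite <- RtoC_inv by lra.
       apply injective_projections; simpl; field; lra. }
  rewrite <- exp_plus.
  eapply Rle_trans; [apply Cmod_ccosh_pow_le|].
  - unfold Rdiv. rewrite Rabs_mult, Rabs_inv, (Rabs_pos_eq (2 * L h)) by lra.
    apply Rmult_le_reg_r with (2 * L h); [lra|].
    rewrite Rmult_assoc, Rinv_l by lra. lra.
  - unfold Rdiv. rewrite Rabs_mult, Rabs_inv, (Rabs_pos_eq (2 * L h)) by lra.
    apply Rmult_le_reg_r with (2 * L h); [lra|].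
    rewrite Rmult_assoc, Rinv_l by lra.
    generalize (Rabs_triang q (2 * PI * v)).
    rewrite (Rabs_mult (2 * PI) v), (Rabs_pos_eq (2 * PI)) by lra.
    generalize (Rabs_pos v). nra.
  - apply exp_le_mono. rewrite mult_INR. fold (L h).
    set (r := INR (M h) / L h) in *.
    replace (L h * INR (M h) * (4 * (p / (2 * L h)) ^ 2
               - ((q + 2 * PI * v) / (2 * L h)) ^ 2 / 36))
      with (r * (p ^ 2 - (q + 2 * PI * v) ^ 2 / 144)) by (unfold r; field; lra).
    assert (Hv2 : 0 <= v ^ 2) by apply pow2_ge_0.
    (* [(q + t)^2 >= t^2 / 2 - q^2] with [t = 2 * PI * v] and [PI > 3]. Divided by 144 this leaves
       [v^2 / 8], and [r >= 1 / (2 tau)] turns it into the rate [1 / (16 tau)]. *)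
    assert (Hsq : (q + 2 * PI * v) ^ 2 >= 18 * v ^ 2 - q ^ 2).
    { assert (0 <= (2 * q + 2 * PI * v) ^ 2) by apply pow2_ge_0.
      assert (9 * v ^ 2 <= (PI * v) ^ 2) by (rewrite Rpow_mult_distr; apply Rmult_le_compat_r; nra).
      nra. }
    assert (Hp2 : 0 <= p ^ 2) by apply pow2_ge_0.
    assert (Hq2 : 0 <= q ^ 2) by apply pow2_ge_0.
    assert (Hit : 0 < / (2 * tau)) by (apply Rinv_0_lt_compat; lra).
    apply Rle_trans with (r * (p ^ 2 + q ^ 2) - r * (v ^ 2 / 8)); [nra|].
    assert (Hr1 : r * (p ^ 2 + q ^ 2) <= 2 / tau * (p ^ 2 + q ^ 2))
      by (apply Rmult_le_compat_r; lra).
    assert (Hr2 : / (2 * tau) * (v ^ 2 / 8) <= r * (v ^ 2 / 8))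
      by (apply Rmult_le_compat_r; lra).
    assert (Hg := gaussian_le_exp (/ (16 * tau)) 0 (Rabs v)
      ltac:(apply Rinv_0_lt_compat; lra)).
    rewrite pow2_abs in Hg.
    replace ((0 + 1) ^ 2 / (4 * / (16 * tau))) with (4 * tau) in Hg by (field; lra).
    replace (/ (16 * tau) * v ^ 2) with (/ (2 * tau) * (v ^ 2 / 8)) in Hg by (field; lra).
    lra.
Qed.

End Scaling.

Definition theta_space (w : C) (tau : R) (mu : Z) : C :=
  let xi := (w + Ci * RtoC (2 * PI * IZR mu))%C in cexp (xi * xi / RtoC (4 * tau)).

Definition theta_freq (w : C) (tau : R) (q : Z) : C :=
  cexp (w * RtoC (IZR q) - RtoC (IZR q ^ 2 * tau)).

Lemma theta_freq_dominated (w : C) (tau : R) (q : Z) :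
  0 < tau ->
  Cmod (theta_freq w tau q) <= exp ((Cmod w + 1) ^ 2 / (4 * tau)) * exp (- Rabs (IZR q)).
Proof.
  intros Ht. unfold theta_freq. rewrite Cmod_cexp, <- exp_plus. apply exp_le_mono.
  generalize (gaussian_le_exp tau (Cmod w) (Rabs (IZR q)) Ht). rewrite pow2_abs.
  assert (Re w * IZR q <= Cmod w * Rabs (IZR q)).
  { eapply Rle_trans; [apply Rle_abs|]. rewrite Rabs_mult.
    apply Rmult_le_compat_r; [apply Rabs_pos | apply re_le_Cmod]. }
  destruct w as [a b]. simpl in *. lra.
Qed.

(** [K] is the Wallis limit. It is quantified before [w] and [tau], so that it can be determined
    from a single instance. *)
Lemma theta_formula_up_to_constant :
  exists K : R, forall (w : C) (tau : R), 0 < tau ->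
  (theta_space w tau 0 + csum (zpair (theta_space w tau))
   = RtoC (sqrt (K * tau)) * (theta_freq w tau 0 + csum (zpair (theta_freq w tau))))%C.
Proof.
  destruct central_binom_sqr_lim as [K [HK0 HK]]. exists K. intros w tau Htau.
  pose (L := fun h => INR (2 * h + 1)).
  assert (HL : forall h, 0 < L h) by (intros; apply scale_pos).
  assert (HLt : forall h, 0 <= L h / tau) by (intros h; left; now apply Rdiv_lt_0_compat).
  (* Rounding down leaves [M / l] between [1 / tau - 1 / l] and [1 / tau]. *)
  pose (M := fun h => nfloor (L h / tau) (HLt h)).
  assert (HMf : forall h, INR (M h) <= L h / tau < INR (M h) + 1).
  { intros h. unfold M, nfloor. now destruct (nfloor_ex (L h / tau) (HLt h)). }
  assert (HM : is_lim_seq (fun h => INR (M h) / L h) (/ tau)).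
  { apply is_lim_seq_le_le with (fun h => / tau - / L h) (fun _ => / tau).
    - intros h. specialize (HMf h). specialize (HL h).
      assert (Hi : 0 < / L h) by now apply Rinv_0_lt_compat.
      assert (HMl : INR (M h) = INR (M h) / L h * L h) by (field; lra).
      assert (Htl : L h / tau = / tau * L h) by (unfold Rdiv; ring).
      assert (H1 : 1 = / L h * L h) by (field; lra).
      split; apply Rmult_le_reg_r with (L h); lra.
    - replace (Finite (/ tau)) with (Finite (/ tau - 0)) by (f_equal; ring).
      apply is_lim_seq_minus'; [apply is_lim_seq_const | apply scale_inv_lim].
    - apply is_lim_seq_const. }
  pose (lhs := fun h => zsumn (fun mu =>
    (ccosh ((w + Ci * RtoC (2 * PI * IZR mu)) / RtoC (2 * L h))
      ^ (2 * ((2 * h + 1) * M h)))%C) h).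
  pose (rhs := fun h => zsumn (fun q =>
    (RtoC (theta_coef M h q) * cexp (w * RtoC (IZR q)))%C) (M h)).
  assert (Heq : forall h, lhs h = rhs h).
  { intros h. unfold lhs, L. rewrite polya_identity.
    unfold rhs, zsumn. apply csumn_ext. intros p Hp. unfold theta_coef.
    rewrite minus_IZR, <- !INR_IZR_INZ.
    enough (Hb : Binomial.C (2 * ((2 * h + 1) * M h)) ((2 * h + 1) * p)
      = Binomial.C (2 * ((2 * h + 1) * M h)) ((2 * h + 1) * M h
          + (2 * h + 1) * Z.to_nat (Z.abs (Z.of_nat p - Z.of_nat (M h)))))
      by (rewrite Hb; reflexivity).
    (* Here [q = p - M]; for negative [q] the reflection of the binomial coefficient brings in
       [|q|]. *)
    destruct (Nat.le_gt_cases (M h) p) as [H|H].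
    - f_equal. rewrite Z.abs_eq by lia.
      replace (Z.to_nat (Z.of_nat p - Z.of_nat (M h))) with (p - M h)%nat by lia. nia.
    - rewrite pascal_step1 by nia. f_equal. rewrite Z.abs_neq by lia.
      replace (Z.to_nat (- (Z.of_nat p - Z.of_nat (M h)))) with (M h - p)%nat by lia. nia. }
  assert (Hl : Clim eventually lhs (theta_space w tau 0 + csum (zpair (theta_space w tau)))%C).
  { destruct (ccosh_pow_dominated tau Htau M HM w) as [B HB].
    apply tannery_zsumn with (K := B) (N := fun h => h).
    - intros P HP; exact HP.
    - exact HB.
    - intros mu. apply ccosh_pow_lim; assumption. }
  pose (f0 := fun q => (RtoC (sqrt (K * tau)) * theta_freq w tau q)%C).
  assert (Hr : Clim eventually rhs (f0 0%Z + csum (zpair f0))%C).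
  { destruct (theta_coef_dominated tau Htau M HM K (Cmod w) HK (Cmod_ge_0 w)) as [B HB].
    apply tannery_zsumn with (K := B).
    - exact (scale_M_lim tau Htau M HM).
    - revert HB; apply filter_imp; intros h Hh q Hq.
      eapply Rle_trans; [|now apply Hh].
      rewrite Cmod_mult, Cmod_R, Rabs_pos_eq.
      2: { unfold theta_coef. left. apply Rmult_lt_0_compat; [apply HL|].
           apply Rdiv_lt_0_compat; [apply Binomial_C_pos | apply pow_lt; lra]. }
      apply Rmult_le_compat_l.
      { unfold theta_coef. left. apply Rmult_lt_0_compat; [apply HL|].
        apply Rdiv_lt_0_compat; [apply Binomial_C_pos | apply pow_lt; lra]. }
      eapply Rle_trans; [apply Cmod_cexp_le|]. apply exp_le_mono.
      rewrite Cmod_mult, Cmod_R. apply Rle_refl.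
    - intros q. unfold f0, theta_freq.
      replace (RtoC (sqrt (K * tau)) * cexp (w * RtoC (IZR q) - RtoC (IZR q ^ 2 * tau)))%C
        with (RtoC (sqrt (K * tau) * exp (- (IZR q ^ 2 * tau))) * cexp (w * RtoC (IZR q)))%C.
      + apply Clim_mult; [|apply Clim_const]. apply Clim_RtoC.
        exact (theta_coef_lim tau Htau M HM K q HK).
      + unfold Cminus. rewrite cexp_plus, <- RtoC_opp, cexp_RtoC, RtoC_mult. ring. }
  rewrite (Clim_unique (F := eventually) lhs _ (f0 0%Z + csum (zpair f0))%C Hl).
  - unfold f0 at 1. rewrite Cmult_plus_distr_l. f_equal.
    rewrite <- (csum_scal _ _ (2 * exp ((Cmod w + 1) ^ 2 / (4 * tau)))).
    + apply csum_ext. intros k. unfold zpair, f0. ring.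
    + apply zpair_bound. intros q. now apply theta_freq_dominated.
  - revert Hr. apply Clim_ext. apply filter_forall. intros h; symmetry; apply Heq.
Qed.

(* At [w = 0], [tau = PI] both series are the same positive number, which pins
   down the Wallis constant without evaluating it. *)
Lemma theta_formula (w : C) (tau : R) :
  0 < tau ->
  (theta_space w tau 0 + csum (zpair (theta_space w tau))
   = RtoC (sqrt (tau / PI)) * (theta_freq w tau 0 + csum (zpair (theta_freq w tau))))%C.
Proof.
  intros Htau. destruct theta_formula_up_to_constant as [K HK].
  assert (HPI := PI_RGT_0).
  assert (HKPI : sqrt (K * PI) = 1).
  { pose (t := fun q : Z => exp (- (PI * IZR q ^ 2))).
    assert (Hf : forall q, theta_freq 0 PI q = RtoC (t q)).
    { intros q. unfold theta_freq, t. rewrite <- cexp_RtoC. f_equal.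
      rewrite RtoC_opp, (Rmult_comm PI). ring. }
    assert (Hs : forall q, theta_space 0 PI q = RtoC (t q)).
    { intros q. unfold theta_space, t. rewrite <- cexp_RtoC. f_equal.
      apply injective_projections; simpl; field; lra. }
    assert (H := HK 0%C PI HPI).
    rewrite (csum_ext (zpair (theta_space 0 PI)) (zpair (fun q => RtoC (t q)))) in H
      by (intros; unfold zpair; now rewrite !Hs).
    rewrite (csum_ext (zpair (theta_freq 0 PI)) (zpair (fun q => RtoC (t q)))) in H
      by (intros; unfold zpair; now rewrite !Hf).
    rewrite Hs, Hf in H.
    set (S := csum (zpair (fun q => RtoC (t q)))) in H.
    (* Positivity of the common value [t 0 + Re S] is what allows cancelling it. *)
    assert (HS : 0 <= Re S).
    { assert (Hc : Clim eventually (csumn (zpair (fun q => RtoC (t q)))) S).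
      { apply csum_correct with (2 * exp ((Cmod 0 + 1) ^ 2 / (4 * PI))).
        apply zpair_bound. intros q. rewrite <- Hf. now apply theta_freq_dominated. }
      apply Rnot_lt_le; intros Hneg.
      destruct (Hc (- Re S)) as [N HN]; [lra|].
      specialize (HN N (le_n _)).
      assert (Hp : 0 <= Re (csumn (zpair (fun q => RtoC (t q))) N)).
      { clear. induction N as [|N IH]; [simpl; lra|].
        assert (Ht : forall q, 0 < t q) by (intros; apply exp_pos).
        cbn [csumn]. rewrite re_plus.
        assert (Hz : Re (zpair (fun q => RtoC (t q)) N)
                     = t (Z.of_nat (S N)) + t (- Z.of_nat (S N))%Z) by reflexivity.
        rewrite Hz. generalize (Ht (Z.of_nat (S N))) (Ht (- Z.of_nat (S N))%Z). lra. }
      generalize (re_le_Cmod (csumn (zpair (fun q => RtoC (t q))) N - S)).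
      unfold Cminus in *. rewrite re_plus, re_opp. intros H1.
      generalize (Rle_abs (Re (csumn (zpair (fun q => RtoC (t q))) N) + - Re S)).
      lra. }
    assert (Hpos : 0 < t 0%Z + Re S) by (generalize (exp_pos (- (PI * 0 ^ 2))); unfold t; lra).
    apply (f_equal Re) in H.
    rewrite re_scal_l, re_plus, re_RtoC in H. nra. }
  rewrite (HK w tau Htau). f_equal. f_equal.
  assert (HK1 : K * PI = 1).
  (* [sqrt] is 0 on negative numbers, so its value 1 rules them out. *)
  { assert (0 <= K * PI). { apply Rnot_lt_le; intros Hn. rewrite sqrt_neg_0 in HKPI; lra. }
    rewrite <- (sqrt_sqrt (K * PI)) by assumption. rewrite HKPI. ring. }
  f_equal. replace K with (/ PI); [unfold Rdiv; ring|].
  apply Rmult_eq_reg_r with PI; [|lra]. rewrite HK1. field. lra.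
Qed.

(** * The integrand *)

Local Open Scope C_scope.

Definition theta_term (z : C) (x : R) (n : Z) : C :=
  cexp ((alpha * z - Ci * RtoC (sqrt PI) * RtoC (IZR n) * RtoC x) ^ 2).

Lemma alpha_sqr : alpha * alpha = - Ci.
Proof.
  unfold alpha. rewrite <- cexp_plus.
  replace (- Ci * RtoC (PI / 4) + - Ci * RtoC (PI / 4)) with ((0, - (PI / 2))%R : C)
    by (apply injective_projections; simpl; field).
  unfold cexp. simpl. rewrite exp_0, cos_neg, sin_neg, cos_PI2, sin_PI2.
  apply injective_projections; simpl; ring.
Qed.

Lemma sqrt_PI_sqr : RtoC (sqrt PI) * RtoC (sqrt PI) = RtoC PI.
Proof. rewrite <- RtoC_mult, sqrt_sqrt; [reflexivity | generalize PI_RGT_0; lra]. Qed.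

Lemma Ci_sqr : Ci * Ci = - (1).
Proof. apply injective_projections; simpl; ring. Qed.

Lemma theta_term_freq (z : C) (x : R) (n : Z) :
  theta_term z x n
  = cexp (- Ci * (z * z))
    * theta_freq (- (2 * Ci * alpha * RtoC (sqrt PI) * z * RtoC x)) (PI * x ^ 2) n.
Proof.
  unfold theta_term, theta_freq. rewrite <- cexp_plus. f_equal.
  rewrite !RtoC_mult, !RtoC_pow, <- sqrt_PI_sqr, <- alpha_sqr.
  transitivity (alpha * alpha * (z * z)
    - 2 * Ci * alpha * RtoC (sqrt PI) * z * RtoC x * RtoC (IZR n)
    + (Ci * Ci) * (RtoC (sqrt PI) * RtoC (sqrt PI)) * (RtoC (IZR n) * RtoC (IZR n))
      * (RtoC x * RtoC x)); [simpl; ring|].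
  rewrite Ci_sqr. simpl. ring.
Qed.

Lemma Cmod_theta_freq_arg (z : C) (x : R) :
  (0 < x)%R ->
  Cmod (- (2 * Ci * alpha * RtoC (sqrt PI) * z * RtoC x))
  = (2 * Cmod alpha * sqrt PI * Cmod z * x)%R.
Proof.
  intros Hx. rewrite Cmod_opp, !Cmod_mult, Cmod_Ci, !Cmod_R, !Rabs_pos_eq;
    [ring | lra | apply sqrt_pos | lra].
Qed.

Lemma theta_term_dominated (z : C) (a : R) :
  (0 < a)%R ->
  exists B, forall x n, (a <= x)%R ->
    (Cmod (theta_term z x n) <= B * exp (- Rabs (IZR n)))%R.
Proof.
  intros Ha. assert (HPI := PI_RGT_0).
  pose (d := (2 * Cmod alpha * sqrt PI * Cmod z)%R).
  assert (Hd : (0 <= d)%R).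
  { unfold d. repeat apply Rmult_le_pos; try apply Cmod_ge_0; try apply sqrt_pos; lra. }
  exists (Cmod (cexp (- Ci * (z * z))) * exp ((d + / a) ^ 2 / (4 * PI)))%R.
  intros x n Hx. rewrite theta_term_freq, Cmod_mult, Rmult_assoc.
  apply Rmult_le_compat_l; [apply Cmod_ge_0|].
  eapply Rle_trans.
  { apply theta_freq_dominated. apply Rmult_lt_0_compat; [lra | apply pow_lt; lra]. }
  apply Rmult_le_compat_r; [left; apply exp_pos|]. apply exp_le_mono.
  rewrite Cmod_theta_freq_arg by lra. fold d.
  (* In this form the bound decreases with [x], so its value at [a] serves the whole half-line. *)
  replace ((d * x + 1) ^ 2 / (4 * (PI * x ^ 2)))%R with ((d + / x) ^ 2 / (4 * PI))%R
    by (field; lra).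
  apply Rmult_le_compat_r; [left; apply Rinv_0_lt_compat; lra|].
  assert (Hi : (/ x <= / a)%R) by (apply Rinv_le_contravar; lra).
  assert (0 < / x)%R by (apply Rinv_0_lt_compat; lra).
  apply pow_incr. lra.
Qed.

Lemma sum_nonzero_theta (z : C) (x : R) :
  (0 < x)%R -> sum_nonzero (theta_term z x) = csum (zpair (theta_term z x)).
Proof.
  intros Hx. destruct (theta_term_dominated z x Hx) as [B HB].
  apply sum_nonzero_zpair with B. intros n. apply HB; lra.
Qed.

(** Decay of order [1/x] suffices, being that of the subtracted term. *)
Lemma sum_nonzero_theta_decay (z : C) :
  exists B, forall x, (1 <= x)%R -> (Cmod (sum_nonzero (theta_term z x)) <= B * / x)%R.
Proof.
  assert (HPI := PI_RGT_0).
  pose (d := (2 * Cmod alpha * sqrt PI * Cmod z)%R).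
  pose (B := (Cmod (cexp (- Ci * (z * z))) * exp ((d + 1) ^ 2 / (4 * PI)))%R).
  assert (HB : (0 <= B)%R) by (apply Rmult_le_pos; [apply Cmod_ge_0 | left; apply exp_pos]).
  exists (2 * (2 * B))%R. intros x Hx.
  assert (Ht : forall n, (Cmod (theta_term z x n) <= B * exp (- (Rabs (IZR n) * x)))%R).
  { intros n. unfold B. rewrite theta_term_freq, Cmod_mult, Rmult_assoc.
    apply Rmult_le_compat_l; [apply Cmod_ge_0|].
    unfold theta_freq. rewrite Cmod_cexp, <- exp_plus. apply exp_le_mono.
    set (w := - (2 * Ci * alpha * RtoC (sqrt PI) * z * RtoC x)).
    assert (Hw : Cmod w = (d * x)%R) by (apply Cmod_theta_freq_arg; lra).
    (* Both the Gaussian and the linear exponent depend on [|n| * x] only. Completing the square in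
       that variable gives [exp (-|n| x)] with a constant free of [x]; then [(k + 1) * x >= x + k]
       splits off the decay in [x]. *)
    generalize (gaussian_le_exp PI d (Rabs (IZR n) * x) HPI).
    rewrite Rpow_mult_distr, pow2_abs.
    assert (H : (Re w * IZR n <= Cmod w * Rabs (IZR n))%R).
    { eapply Rle_trans; [apply Rle_abs|]. rewrite Rabs_mult.
      apply Rmult_le_compat_r; [apply Rabs_pos | apply re_le_Cmod]. }
    rewrite Hw in H. unfold Cminus. rewrite re_plus, re_scal_r, re_opp, re_RtoC. lra. }
  rewrite sum_nonzero_theta by lra.
  assert (Hz : forall k, (Cmod (zpair (theta_term z x) k)
                          <= 2 * B * exp (- x) * exp (- INR k))%R).
  { intros k. unfold zpair. eapply Rle_trans; [apply Cmod_triangle|].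
    generalize (Ht (Z.of_nat (S k))) (Ht (- Z.of_nat (S k))%Z).
    rewrite opp_IZR, Rabs_Ropp, <- INR_IZR_INZ, Rabs_pos_eq by apply pos_INR.
    assert (He : (exp (- (INR (S k) * x)) <= exp (- x) * exp (- INR k))%R).
    { rewrite <- exp_plus. apply exp_le_mono. rewrite S_INR.
      generalize (pos_INR k). nra. }
    nra. }
  eapply Rle_trans; [apply csum_bound; exact Hz|].
  assert (He : (exp (- x) <= / x)%R).
  { rewrite exp_Ropp. apply Rinv_le_contravar; [lra|].
    generalize (exp_ineq1_le x). lra. }
  nra.
Qed.

Lemma sum_nonzero_theta_Clim (z : C) (x : R) :
  (0 < x)%R ->
  Clim (locally x) (fun t => sum_nonzero (theta_term z t)) (sum_nonzero (theta_term z x)).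
Proof.
  intros Hx. rewrite sum_nonzero_theta by exact Hx.
  assert (Hloc : locally x (fun t => (x / 2 <= t)%R)).
  { assert (Hx2 : (0 < x / 2)%R) by lra. exists (mkposreal _ Hx2). intros t Ht.
    apply Rabs_def2 in Ht. simpl in Ht. unfold minus, plus, opp in Ht. simpl in Ht. lra. }
  apply Clim_ext with (fun t => csum (zpair (theta_term z t))).
  { revert Hloc. apply filter_imp. intros t Ht. symmetry. apply sum_nonzero_theta. lra. }
  destruct (theta_term_dominated z (x / 2)) as [B HB]; [lra|].
  apply tannery with (2 * B)%R.
  - revert Hloc. apply filter_imp. intros t Ht. apply zpair_bound. auto.
  - apply zpair_lim. intros n. unfold theta_term. apply Clim_cexp. simpl.
    assert (Hid : Clim (locally x) (fun t => alpha * z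
        - Ci * RtoC (sqrt PI) * RtoC (IZR n) * RtoC t)
        (alpha * z - Ci * RtoC (sqrt PI) * RtoC (IZR n) * RtoC x)).
    { apply Clim_ext with (fun t => alpha * z
        + (- (Ci * RtoC (sqrt PI) * RtoC (IZR n))) * RtoC t).
      - apply filter_forall; intros t; ring.
      - replace (alpha * z - Ci * RtoC (sqrt PI) * RtoC (IZR n) * RtoC x)
          with (alpha * z + (- (Ci * RtoC (sqrt PI) * RtoC (IZR n))) * RtoC x) by ring.
        apply Clim_plus; [apply Clim_const|]. apply Clim_scal, Clim_RtoC.
        apply filterlim_id. }
    apply Clim_mult; [exact Hid|]. apply Clim_mult; [exact Hid | apply Clim_const].
Qed.

Lemma phi_zeta_integrand_continuous (s z : C) (x : R) :
  (0 < x)%R -> continuous (U := C_R_CompleteNormedModule) (phi_zeta_integrand s z) x.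
Proof.
  intros Hx.
  apply (proj1 (Clim_filterlim (F := locally x) (phi_zeta_integrand s z)
    (phi_zeta_integrand s z x))).
  unfold phi_zeta_integrand. apply Clim_mult.
  - apply Clim_plus; [now apply (sum_nonzero_theta_Clim z x)|].
    assert (Hinv : forall t, (t <> 0)%R -> RtoC (- / t) = - (1 / RtoC t)).
    { intros t Ht. rewrite RtoC_opp, RtoC_inv by exact Ht. unfold Cdiv. ring. }
    rewrite <- Hinv by lra.
    apply Clim_ext with (fun t => RtoC (- / t)).
    + exists (mkposreal x Hx). intros t Ht. apply Hinv.
      apply Rabs_def2 in Ht. simpl in Ht. unfold minus, plus, opp in Ht. simpl in Ht. lra.
    + apply Clim_RtoC.
      apply (continuous_opp (V := R_NormedModule)), continuous_Rinv. lra.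
  - unfold cpower. apply Clim_cexp, Clim_scal, Clim_RtoC.
    apply (continuity_pt_filterlim ln). apply derivable_continuous_pt.
    exists (/ x)%R. now apply derivable_pt_lim_ln.
Qed.

Lemma cpower_inv (x : R) (s : C) :
  (0 < x)%R -> cpower (/ x) s = cpower x (- s).
Proof.
  intros Hx. unfold cpower. rewrite ln_Rinv, RtoC_opp by exact Hx. f_equal. ring.
Qed.

Lemma cpower_plus_1 (x : R) (s : C) :
  (0 < x)%R -> cpower x (1 + s) = RtoC x * cpower x s.
Proof.
  intros Hx. unfold cpower. rewrite Cmult_plus_distr_r, cexp_plus, Cmult_1_l, cexp_RtoC.
  now rewrite exp_ln.
Qed.

(** The rotation to [i z] matches the two sides: at [(i z, 1/x)] the linear coefficient
    [-2 i alpha sqrt pi (i z) / x] is the [w] for which the space side is the theta series of [z] at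
    [x]. *)
Lemma theta_modular (z : C) (x : R) :
  (0 < x)%R ->
  sum_nonzero (theta_term z x) - 1 / RtoC x
  = RtoC (/ x) * cexp (- Ci * (z * z))
    * (sum_nonzero (theta_term (Ci * z) (/ x)) - 1 / RtoC (/ x)).
Proof.
  intros Hx. assert (HPI := PI_RGT_0).
  assert (Hy : (0 < / x)%R) by now apply Rinv_0_lt_compat.
  assert (HxC : RtoC x <> 0) by (intros E; apply RtoC_inj in E; lra).
  assert (Hsp : RtoC (sqrt PI) <> 0).
  { intros E; apply RtoC_inj in E. generalize (sqrt_lt_R0 PI HPI). lra. }
  pose (tau := (PI * (/ x) ^ 2)%R). pose (w := 2 * RtoC (sqrt PI) * RtoC (/ x) * alpha * z).
  assert (Htau : (0 < tau)%R) by (unfold tau; apply Rmult_lt_0_compat; [lra | now apply pow_lt]).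
  assert (Hsq : sqrt (tau / PI) = (/ x)%R).
  { unfold tau. replace (PI * (/ x) ^ 2 / PI)%R with (Rsqr (/ x)) by (unfold Rsqr; field; lra).
    apply sqrt_Rsqr; lra. }
  (* The reflection of [n] is harmless, since [zpair] is symmetric. *)
  assert (Hs : forall n, theta_space w tau n = theta_term z x (- n)).
  { intros n. unfold theta_space, theta_term, w, tau. f_equal.
    rewrite opp_IZR, !RtoC_mult, !RtoC_pow, !RtoC_opp, !RtoC_inv, <- sqrt_PI_sqr by lra.
    simpl. field. auto. }
  assert (Hf : forall n, theta_term (Ci * z) (/ x) n = cexp (Ci * (z * z)) * theta_freq w tau n).
  { intros n. rewrite theta_term_freq.
    replace (- Ci * (Ci * z * (Ci * z))) with (- (Ci * Ci) * (Ci * (z * z))) by ring.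
    replace (- (2 * Ci * alpha * RtoC (sqrt PI) * (Ci * z) * RtoC (/ x)))
      with (- (Ci * Ci) * w) by (unfold w; ring).
    rewrite Ci_sqr. fold tau. f_equal; f_equal; ring. }
  generalize (theta_formula w tau Htau). rewrite Hsq.
  rewrite (csum_ext _ (zpair (theta_term z x))).
  2: { intros k. unfold zpair. rewrite !Hs, Z.opp_involutive. ring. }
  assert (Hcf : csum (zpair (theta_term (Ci * z) (/ x)))
     = cexp (Ci * (z * z)) * csum (zpair (theta_freq w tau))).
  { rewrite <- (csum_scal _ _ (2 * exp ((Cmod w + 1) ^ 2 / (4 * tau)))).
    - apply csum_ext. intros k. unfold zpair. rewrite !Hf. ring.
    - apply zpair_bound. intros q. now apply theta_freq_dominated. }
  rewrite (sum_nonzero_theta (Ci * z) (/ x) Hy), Hcf, (sum_nonzero_theta z x Hx).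
  assert (Hs0 : theta_space w tau 0 = cexp (- Ci * (z * z))).
  { rewrite Hs. unfold theta_term. f_equal. rewrite <- alpha_sqr. simpl. ring. }
  assert (Hf0 : theta_freq w tau 0 = 1).
  { unfold theta_freq. rewrite <- cexp_0. f_equal.
    replace (0 ^ 2 * tau)%R with 0%R by ring. ring. }
  rewrite Hs0, Hf0. intros H.
  assert (Hinv : cexp (- Ci * (z * z)) * cexp (Ci * (z * z)) = 1).
  { rewrite <- cexp_plus, <- cexp_0. f_equal. ring. }
  set (e := cexp (- Ci * (z * z))) in *. set (e' := cexp (Ci * (z * z))) in *.
  set (S1 := csum (zpair (theta_term z x))) in *. set (S2 := csum (zpair (theta_freq w tau))) in *.
  replace S1 with ((e + S1) - e) by ring. rewrite H.
  transitivity (RtoC (/ x) * ((e * e') * S2) - e).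
  - rewrite Hinv, RtoC_inv by lra. field. exact HxC.
  - rewrite RtoC_inv by lra. field. exact HxC.
Qed.

(** One factor [1/x] comes from the theta formula, the other from [x^(-s) = (1/x) * (1/x)^(-(1-s))];
    together they form the Jacobian of inversion up to sign. *)
Lemma phi_zeta_integrand_modular (s z : C) (x : R) :
  (0 < x)%R ->
  phi_zeta_integrand s z x
  = cexp (- Ci * (z * z)) * (RtoC (/ x ^ 2) * phi_zeta_integrand (1 - s) (Ci * z) (/ x)).
Proof.
  intros Hx.
  assert (Hy : (0 < / x)%R) by now apply Rinv_0_lt_compat.
  unfold phi_zeta_integrand.
  change (sum_nonzero (fun n => cexp ((alpha * z
    - Ci * RtoC (sqrt PI) * RtoC (IZR n) * RtoC x) ^ 2))) with (sum_nonzero (theta_term z x)).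
  change (sum_nonzero (fun n => cexp ((alpha * (Ci * z)
    - Ci * RtoC (sqrt PI) * RtoC (IZR n) * RtoC (/ x)) ^ 2)))
    with (sum_nonzero (theta_term (Ci * z) (/ x))).
  rewrite theta_modular by exact Hx.
  replace (cpower x (- s)) with (RtoC (/ x) * cpower (/ x) (- (1 - s))).
  - rewrite <- pow_inv, RtoC_pow. simpl. ring.
  - rewrite <- cpower_plus_1 by exact Hy. replace (1 + - (1 - s)) with s by ring.
    now rewrite cpower_inv.
Qed.

Lemma phi_zeta_integrand_decay (s z : C) :
  exists B, forall x, (1 <= x)%R ->
    (Cmod (phi_zeta_integrand s z x) <= B * exp (- (1 + Re s) * ln x))%R.
Proof.
  destruct (sum_nonzero_theta_decay z) as [B HB].
  exists (B + 1)%R. intros x Hx. unfold phi_zeta_integrand. rewrite Cmod_mult.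
  assert (H1 : (Cmod (cpower x (- s)) = exp (- Re s * ln x))%R).
  { unfold cpower. rewrite Cmod_cexp, re_scal_r, re_opp. reflexivity. }
  rewrite H1.
  replace (- (1 + Re s) * ln x)%R with (- ln x + - Re s * ln x)%R by ring.
  rewrite exp_plus, exp_Ropp, exp_ln, <- Rmult_assoc by lra.
  apply Rmult_le_compat_r; [left; apply exp_pos|].
  eapply Rle_trans; [apply (Cmod_triangle _ (- (1 / RtoC x)))|]. rewrite Cmod_opp.
  assert (H2 : Cmod (1 / RtoC x) = (/ x)%R).
  { unfold Cdiv. rewrite Cmult_1_l, <- RtoC_inv, Cmod_R by lra.
    apply Rabs_pos_eq. left; apply Rinv_0_lt_compat; lra. }
  rewrite H2. generalize (HB x Hx). unfold theta_term. lra.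
Qed.

(** * The improper integral *)

(** Scalars of [C_R_NormedModule] are real, so a complex factor is not a case of [scal] and has to
    be carried through the Riemann sums. *)
Lemma Riemann_sum_Cmult (c : C) (f : R -> C) (ptd : SF_seq) :
  Riemann_sum (V := C_R_NormedModule) (fun x => c * f x) ptd
  = c * Riemann_sum (V := C_R_NormedModule) f ptd.
Proof.
  apply (SF_cons_ind (fun ptd =>
    Riemann_sum (V := C_R_NormedModule) (fun x => c * f x) ptd
    = c * Riemann_sum (V := C_R_NormedModule) f ptd)); clear ptd.
  - intros x0. unfold Riemann_sum; simpl.
    apply injective_projections; simpl; unfold zero; simpl; ring.
  - intros h ptd IH. rewrite !Riemann_sum_cons, IH.
    destruct c as [c1 c2], (f (snd h)) as [f1 f2],
      (Riemann_sum (V := C_R_NormedModule) f ptd) as [r1 r2].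
    apply injective_projections; simpl; unfold plus, scal, mult; simpl;
      unfold mult; simpl; ring.
Qed.

Lemma is_RInt_Cmult (c : C) (f : R -> C) (a b : R) (l : C) :
  is_RInt (V := C_R_NormedModule) f a b l ->
  is_RInt (V := C_R_NormedModule) (fun x => c * f x) a b (c * l).
Proof.
  unfold is_RInt. rewrite <- !Clim_filterlim. intros H.
  apply Clim_ext with (fun ptd =>
    c * scal (V := C_R_NormedModule) (sign (b - a)) (Riemann_sum (V := C_R_NormedModule) f ptd)).
  - apply filter_forall; intros ptd. rewrite Riemann_sum_Cmult.
    destruct c as [c1 c2], (Riemann_sum (V := C_R_NormedModule) f ptd) as [r1 r2].
    apply injective_projections; simpl; unfold scal, mult; simpl; unfold mult; simpl; ring.
  - now apply Clim_scal.
Qed.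

Local Notation CRInt := (RInt (V := C_R_CompleteNormedModule)).

Lemma CRInt_correct (f : R -> C) (a b : R) :
  (forall x, (0 < x)%R -> continuous (U := C_R_CompleteNormedModule) f x) ->
  (0 < a)%R -> (0 < b)%R ->
  is_RInt (V := C_R_CompleteNormedModule) f a b (CRInt f a b).
Proof.
  intros Hf Ha Hb. apply (RInt_correct (V := C_R_CompleteNormedModule)).
  apply (ex_RInt_continuous (V := C_R_CompleteNormedModule)).
  intros x Hx. apply Hf. generalize (Rmin_glb_lt a b 0 Ha Hb). lra.
Qed.

Lemma CRInt_power_bound (f : R -> C) (B sigma u v : R) :
  (forall x, (0 < x)%R -> continuous (U := C_R_CompleteNormedModule) f x) ->
  (0 < sigma)%R ->
  (forall x, (1 <= x)%R -> (Cmod (f x) <= B * exp (- (1 + sigma) * ln x))%R) ->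
  (1 <= u <= v)%R ->
  (Cmod (CRInt f u v) <= B / sigma * exp (- sigma * ln u))%R.
Proof.
  intros Hf Hs HB [Hu Huv].
  assert (HB0 : (0 <= B)%R).
  { generalize (HB 1%R (Rle_refl 1)) (Cmod_ge_0 (f 1%R)). rewrite ln_1, Rmult_0_r, exp_0. lra. }
  pose (P := fun x => (- (B / sigma) * exp (- sigma * ln x))%R).
  assert (HI : is_RInt (fun x => (B * exp (- (1 + sigma) * ln x))%R) u v (minus (P v) (P u))).
  { apply (is_RInt_derive (V := R_CompleteNormedModule) P);
      intros x; rewrite Rmin_left, Rmax_right by lra; intros Hx.
    - unfold P. auto_derive; [lra|].
      replace (- (1 + sigma) * ln x)%R with (- ln x + - sigma * ln x)%R by ring.
      rewrite exp_plus, exp_Ropp, exp_ln by lra. field. lra.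
    - apply (ex_derive_continuous (V := R_NormedModule)). auto_derive. lra. }
  assert (HN := norm_RInt_le (V := C_R_NormedModule) f
    (fun x => (B * exp (- (1 + sigma) * ln x))%R) u v (CRInt f u v) (P v - P u)%R Huv).
  rewrite Cmod_norm. eapply Rle_trans; [apply HN; clear HN|].
  - intros x Hx. rewrite <- Cmod_norm. apply HB. lra.
  - apply CRInt_correct; auto; lra.
  - exact HI.
  - unfold minus, plus, opp, P; simpl.
    assert (0 <= B / sigma)%R by (apply Rmult_le_pos; [lra | left; now apply Rinv_0_lt_compat]).
    generalize (exp_pos (- sigma * ln v)). nra.
Qed.

Lemma improper_CRInt_cv (f : R -> C) (B sigma : R) :
  (forall x, (0 < x)%R -> continuous (U := C_R_CompleteNormedModule) f x) ->
  (0 < sigma)%R ->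
  (forall x, (1 <= x)%R -> (Cmod (f x) <= B * exp (- (1 + sigma) * ln x))%R) ->
  exists l, Clim (Rbar_locally p_infty) (fun b => CRInt f 1 b) l.
Proof.
  intros Hf Hs HB.
  assert (HB0 : (0 <= B)%R).
  { generalize (HB 1%R (Rle_refl 1)) (Cmod_ge_0 (f 1%R)). rewrite ln_1, Rmult_0_r, exp_0. lra. }
  assert (Hsmall : forall eps, (0 < eps)%R -> exists U, (1 <= U)%R /\
    forall u, (U <= u)%R -> (B / sigma * exp (- sigma * ln u) < eps)%R).
  { intros eps He. pose (t := (B / (sigma * sigma * eps))%R).
    assert (Ht : (0 <= t)%R).
    { apply Rmult_le_pos; [lra | left; apply Rinv_0_lt_compat].
      repeat apply Rmult_lt_0_compat; lra. }
    exists (exp t). split; [rewrite <- exp_0; now apply exp_le_mono|].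
    intros u Hu. assert (Hu0 : (0 < u)%R) by (generalize (exp_pos t); lra).
    assert (Hlu : (t <= ln u)%R).
    { rewrite <- (ln_exp t). destruct Hu as [Hu| ->]; [|lra].
      left. apply ln_increasing; [apply exp_pos | exact Hu]. }
    replace (- sigma * ln u)%R with (- (sigma * ln u))%R by ring.
    rewrite exp_Ropp.
    apply Rmult_lt_reg_r with (exp (sigma * ln u)); [apply exp_pos|].
    rewrite Rmult_assoc, Rinv_l by (apply Rgt_not_eq, exp_pos).
    assert (H1 := exp_ineq1_le (sigma * ln u)).
    assert (H2 : (B / sigma = eps * (sigma * t))%R) by (unfold t; field; lra).
    rewrite H2, Rmult_1_r. apply Rmult_lt_compat_l; [lra|].
    assert (sigma * t <= sigma * ln u)%R by (apply Rmult_le_compat_l; lra). lra. }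
  destruct (proj1 (filterlim_locally_cauchy (U := C_R_CompleteNormedModule)
    (F := Rbar_locally p_infty) (fun b => CRInt f 1 b))) as [l Hl].
  2: { exists l. now apply Clim_filterlim. }
  intros eps. destruct (Hsmall eps (cond_pos eps)) as [U [HU1 HU]].
  exists (fun u => (U < u)%R). split; [now exists U|].
  assert (Hord : forall u v, (U < u)%R -> (u <= v)%R ->
    (Cmod (CRInt f 1 v - CRInt f 1 u) < eps)%R).
  { intros u v Hu Huv.
    assert (HC : CRInt f 1 v = CRInt f 1 u + CRInt f u v).
    { symmetry. apply (RInt_Chasles (V := C_R_CompleteNormedModule));
        eexists; apply CRInt_correct; auto; lra. }
    assert (Hring : forall a b : C, a + b - a = b) by (intros; ring).
    rewrite HC, Hring.
    eapply Rle_lt_trans; [apply (CRInt_power_bound f B sigma); auto; lra|].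
    apply HU. lra. }
  intros u v Hu Hv.
  apply (norm_compat1 (V := C_R_NormedModule)).
  change (norm (V := C_R_NormedModule) (CRInt f 1 v - CRInt f 1 u)%C < eps)%R.
  rewrite <- Cmod_norm.
  destruct (Rle_dec u v) as [H|H]; [now apply Hord|].
  rewrite <- Cmod_opp, Copp_minus_distr.
  apply Hord; lra.
Qed.

Lemma is_RInt_gen_at_infinity (f : R -> C) (l : C) :
  (forall x, (0 < x)%R -> continuous (U := C_R_CompleteNormedModule) f x) ->
  Clim (Rbar_locally p_infty) (fun b => CRInt f 1 b) l ->
  is_RInt_gen (V := C_R_NormedModule) f (at_point 1%R) (Rbar_locally p_infty) l.
Proof.
  intros Hf Hl P HP. apply Clim_filterlim in Hl. specialize (Hl P HP).
  apply (Filter_prod _ _ _ (fun a => a = 1%R)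
    (fun b => (0 < b)%R /\ P (CRInt f 1 b))).
  - reflexivity.
  - apply filter_and; [now exists 0%R | exact Hl].
  - intros a b -> [Hb Hp]. exists (CRInt f 1 b). split; [|exact Hp].
    apply CRInt_correct; auto; lra.
Qed.

(** The minus sign of the derivative of [1/x] cancels the one from reversing the bounds [1] and
    [1/a]. *)
Lemma is_RInt_inversion (f g : R -> C) (c : C) (a : R) :
  (forall x, (0 < x)%R -> continuous (U := C_R_CompleteNormedModule) g x) ->
  (forall x, (0 < x)%R -> f x = c * (RtoC (/ x ^ 2) * g (/ x)%R)) ->
  (0 < a)%R -> is_RInt (V := C_R_NormedModule) f a 1 (c * CRInt g 1 (/ a)).
Proof.
  intros Hg Hfg Ha.
  assert (Hm := Rmin_glb_lt a 1 0 Ha Rlt_0_1).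
  assert (Hia : (0 < / a)%R) by now apply Rinv_0_lt_compat.
  assert (H := is_RInt_comp (V := C_R_CompleteNormedModule) g Rinv
    (fun x => (- / x ^ 2)%R) a 1).
  rewrite Rinv_1 in H.
  rewrite <- (opp_RInt_swap (V := C_R_CompleteNormedModule) g 1 (/ a)) in H
    by (eexists; apply CRInt_correct; auto; lra).
  assert (Hring : forall u v : C, u * v = (- u) * (- v)) by (intros; ring).
  rewrite Hring.
  apply (is_RInt_ext (V := C_R_NormedModule) (fun x => (- c) *
    (scal (V := C_R_NormedModule) (- / x ^ 2)%R (g (/ x)%R)))).
  - intros x Hx. rewrite Hfg by lra. rewrite scal_R_Cmult, RtoC_opp.
    match goal with |- ?u = ?v => change (@eq C u v) end. ring.
  - apply is_RInt_Cmult. apply H.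
    + intros x Hx. apply Hg. apply Rinv_0_lt_compat. lra.
    + intros x Hx. split.
      * auto_derive; [lra | field; lra].
      * apply (ex_derive_continuous (V := R_NormedModule)). auto_derive.
        apply Rgt_not_eq. nra.
Qed.

(** Convergence at 0 is inherited from convergence of the transformed integral at infinity. *)
Lemma is_RInt_gen_inversion (f g : R -> C) (c l : C) :
  (forall x, (0 < x)%R -> continuous (U := C_R_CompleteNormedModule) g x) ->
  (forall x, (0 < x)%R -> f x = c * (RtoC (/ x ^ 2) * g (/ x)%R)) ->
  Clim (Rbar_locally p_infty) (fun b => CRInt g 1 b) l ->
  is_RInt_gen (V := C_R_NormedModule) f (at_right 0) (at_point 1%R) (c * l).
Proof.
  intros Hg Hfg Hl.
  assert (Hcl : Clim (at_right 0) (fun a => c * CRInt g 1 (/ a)) (c * l)).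
  { apply Clim_scal. intros eps He. exact (filterlim_Rinv_0_right _ (Hl eps He)). }
  intros P HP. apply Clim_filterlim in Hcl. specialize (Hcl P HP).
  apply (Filter_prod _ _ _ (fun a => (0 < a)%R /\ P (c * CRInt g 1 (/ a)))
    (fun b => b = 1%R)).
  - apply filter_and; [|exact Hcl]. exists (mkposreal 1 Rlt_0_1). intros y _ Hy; exact Hy.
  - reflexivity.
  - intros a b [Ha Hp] ->. exists (c * CRInt g 1 (/ a)). split; [|exact Hp].
    now apply is_RInt_inversion.
Qed.

Theorem mainTheorem4 (s : C) (hs : (0 < Re s < 1)%R) (z : R) :
  phi_zeta s (RtoC z) = phi_zeta (1 - s)%C (Ci * RtoC z)%C.
Proof.
  set (f := phi_zeta_integrand s (RtoC z)).
  set (g := phi_zeta_integrand (1 - s) (Ci * RtoC z)).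
  set (e := cexp (- Ci * (RtoC z * RtoC z))). set (e' := cexp (Ci * (RtoC z * RtoC z))).
  assert (Hee : e' * e = 1).
  { unfold e, e'. rewrite <- cexp_plus, <- cexp_0. f_equal. ring. }
  assert (Hcf : forall x, (0 < x)%R -> continuous (U := C_R_CompleteNormedModule) f x)
    by (intros; now apply phi_zeta_integrand_continuous).
  assert (Hcg : forall x, (0 < x)%R -> continuous (U := C_R_CompleteNormedModule) g x)
    by (intros; now apply phi_zeta_integrand_continuous).
  assert (Hfg : forall x, (0 < x)%R -> f x = e * (RtoC (/ x ^ 2) * g (/ x)%R))
    by (intros; now apply phi_zeta_integrand_modular).
  (* A second use of the covariance lemma would lead to [-z]; solving [Hfg] for [g] returns to [z]
     itself. *)
  assert (Hgf : forall x, (0 < x)%R -> g x = e' * (RtoC (/ x ^ 2) * f (/ x)%R)).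
  { intros x Hx. rewrite Hfg, Rinv_inv by now apply Rinv_0_lt_compat.
    transitivity ((e' * e) * (RtoC (/ x ^ 2 * / (/ x) ^ 2) * g x)).
    - rewrite Hee. replace (/ x ^ 2 * / (/ x) ^ 2)%R with 1%R by (field; lra). ring.
    - rewrite RtoC_mult. ring. }
  destruct (phi_zeta_integrand_decay s (RtoC z)) as [B1 HB1].
  destruct (phi_zeta_integrand_decay (1 - s) (Ci * RtoC z)) as [B2 HB2].
  destruct (improper_CRInt_cv f B1 (Re s) Hcf (proj1 hs) HB1) as [lf Hlf].
  (* This is where [Re s < 1] enters: it gives convergence of [g] at infinity, that is, of [f] at
     0. *)
  assert (Hs1 : (0 < Re (1 - s))%R) by (simpl; unfold Re in hs; lra).
  destruct (improper_CRInt_cv g B2 (Re (1 - s)) Hcg Hs1 HB2) as [lg Hlg].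
  assert (HIf : RInt_gen (V := C_R_CompleteNormedModule) f (at_right 0) (Rbar_locally p_infty)
                = e * lg + lf).
  { apply (is_RInt_gen_unique (V := C_R_CompleteNormedModule)).
    apply (is_RInt_gen_Chasles (V := C_R_NormedModule) f 1%R).
    - now apply is_RInt_gen_inversion with g.
    - now apply is_RInt_gen_at_infinity. }
  assert (HIg : RInt_gen (V := C_R_CompleteNormedModule) g (at_right 0) (Rbar_locally p_infty)
                = e' * lf + lg).
  { apply (is_RInt_gen_unique (V := C_R_CompleteNormedModule)).
    apply (is_RInt_gen_Chasles (V := C_R_NormedModule) g 1%R).
    - now apply is_RInt_gen_inversion with f.
    - now apply is_RInt_gen_at_infinity. }
  unfold phi_zeta. fold f g. rewrite HIf, HIg.
  (* The prefactors differ exactly by [e], and [e * (e' * lf + lg)] is [lf + e * lg]. *)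
  assert (He1 : cexp (Ci * ((Ci * RtoC z) ^ 2 / 2)) = e * cexp (Ci * (RtoC z ^ 2 / 2))).
  { unfold e. rewrite <- cexp_plus. f_equal.
    transitivity ((Ci * Ci) * (Ci * (RtoC z * RtoC z / 2))); [simpl; unfold Cdiv; ring|].
    rewrite Ci_sqr. simpl. field. }
  rewrite He1.
  transitivity (cexp (Ci * (RtoC z ^ 2 / 2)) * (e * lg + (e' * e) * lf));
    [rewrite Hee|]; ring.
Qed.
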